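(* Let $t\in\mathbb R\setminus\{0\}$. The space $\mathbf H_{2,\circledast}^t$, that is $\mathbf H_2^t$ endowed with the $\mathbb H_t$-valued form $$[f,g]_{\circledast}=\sum_{n=0}^\infty\delta_n^{\circledast}\gamma_n,\qquad f(q_t)=\sum_{n=0}^\infty q_t^n\gamma_n,\quad g(q_t)=\sum_{n=0}^\infty q_t^n\delta_n,$$ and the associated real inner product ${\rm Tr}\,[f,g]_{\circledast}=\sum_{n=0}^\infty{\rm Tr}\,(\delta_n^{\circledast}\gamma_n)$ (which is indefinite when $t>0$ and definite when $t<0$), is a reproducing kernel Krein right $\mathbb H_t$-module with reproducing kernel $$K(q_t,p_t)=\sum_{n=0}^\infty q_t^n\,p_t^{\circledast n}.$$
   Context: For $t\in\mathbb R\setminus\{0\}$, $\mathbb H_t$ is the real algebra (matrix addition and multiplication) of matrices $q_t=\begin{pmatrix}a&tb\\ \overline b&\overline a\end{pmatrix}$, $a,b\in\mathbb C$; $q_t^{\circledast}=\begin{pmatrix}\overline a&-tb\\ -\overline b&a\end{pmatrix}$, and $p^{\circledast n}=(p^{\circledast})^n$. $\|q_t\|_E=\sqrt{|a|^2+|t||b|^2}$, and $\|q_t\|_{op}$ is the operator norm of the matrix $q_t$ on $\mathbb C^2$. $\mathbf H_2^t$ is the space of power series $f(q_t)=\sum_{n=0}^\infty q_t^n\alpha_n$, $\alpha_n\in\mathbb H_t$, with $\sum_n\|\alpha_n\|_E^2<\infty$; they converge for $\|q_t\|_{op}<1$, so are functions on $\Omega=\{q_t\in\mathbb H_t:\|q_t\|_{op}<1\}$;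 $\mathbb H_t$ acts on the right by multiplying coefficients on the right. A real Krein space is a real vector space with a symmetric bilinear form admitting a direct, orthogonal decomposition $\mathcal V_++\mathcal V_-$ with $(\mathcal V_+,[\cdot,\cdot])$ and $(\mathcal V_-,-[\cdot,\cdot])$ Hilbert spaces. A Krein right $\mathbb H_t$-module (for $\circledast$) is a right $\mathbb H_t$-module $\mathcal K$ with an $\mathbb H_t$-valued form satisfying $[vq,wp]=p^{\circledast}[v,w]q$ for $v,w\in\mathcal K$, $p,q\in\mathbb H_t$, and which is a real Krein space for ${\rm Tr}\,[v,w]$. If $\mathcal K$ consists of $\mathbb H_t$-valued functions on a set $\Omega$, it is a reproducing kernel Krein module with reproducing kernel $K(z,w)$, $z,w\in\Omega$, if $K(\cdot,w)b\in\mathcal K$ and ${\rm Tr}\,[f(\cdot),K(\cdot,w)b]={\rm Tr}\,(b^{\circledast}f(w))$ for all $f\in\mathcal K$, $w\in\Omega$, $b\in\mathbb H_t$. *)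

(* Defs.v *)
From HB Require Import structures.
From mathcomp Require Import all_boot all_order all_algebra.
From mathcomp Require Import complex.
From mathcomp Require Import all_classical all_reals all_analysis.

Set Implicit Arguments.
Unset Strict Implicit.
Unset Printing Implicit Defensive.
Import Order.TTheory GRing.Theory Num.Theory.
Import numFieldNormedType.Exports.
Import ComplexField Normc.
Local Open Scope classical_set_scope.
Local Open Scope ring_scope.
Local Open Scope complex_scope.

Section HtMatrix.
Context {R : realType} (t : R).
Implicit Types (a b : R[i]) (M : 'M[R[i]]_2).

Definition ht_mx a b : 'M[R[i]]_2 :=
  \matrix_(i, j)
    if i == 0 then (if j == 0 then a else t%:C * b)
    else (if j == 0 then conjc b else conjc a).

Definition ht_pred : {pred 'M[R[i]]_2} :=
  fun M => `[< exists a b, M = ht_mx a b >].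

Lemma ht_mxP a b : ht_mx a b \in ht_pred.
Proof. by apply/asboolP; exists a, b. Qed.

Lemma ht_pred_subring : subring_closed ht_pred.
Proof.
have sumE (f : 'I_2 -> R[i]) : \sum_i f i = f 0 + f 1.
  by rewrite big_ord_recl big_ord1; congr (_ + f _); apply/val_inj.
split.
- apply/asboolP; exists 1, 0; apply/matrixP => i j; rewrite !mxE mulr0 conjc0 conjc1.
  by case: i j => [[|[|//]] ?] [[|[|//]] ?].
- move=> _ _ /asboolP[a [b ->]] /asboolP[c [d ->]].
  apply/asboolP; exists (a - c), (b - d); apply/matrixP => i j.
  rewrite !mxE !rmorphB mulrBr.
  by case: eqP => _; case: eqP.
- move=> _ _ /asboolP[a [b ->]] /asboolP[c [d ->]].
  apply/asboolP; exists (a * c + t%:C * b * conjc d), (a * d + b * conjc c).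
  apply/matrixP => i j; rewrite !mxE sumE !mxE /=.
  case: i j => [[|[|//]] ?] [[|[|//]] ?] /=; first by [].
  + by rewrite mulrDr !mulrA (mulrC a).
  + by rewrite rmorphD !rmorphM /= conjcK addrC.
  + by rewrite rmorphD !rmorphM /= conjcK oppr0 mulrA (mulrC (conjc b)) addrC.
Qed.

HB.instance Definition _ :=
  GRing.isSubringClosed.Build 'M[R[i]]_2 ht_pred ht_pred_subring.

Record Ht := MkHt { ht_val :> 'M[R[i]]_2; ht_valP : ht_val \in ht_pred }.

HB.instance Definition _ := [isSub for ht_val].
HB.instance Definition _ := [Choice of Ht by <:].
HB.instance Definition _ := [SubChoice_isSubNzRing of Ht by <:].

Definition ht (a b : R[i]) : Ht := MkHt (ht_mxP a b).

Definition ht_a (q : Ht) : R[i] := ht_val q 0 0.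
Definition ht_b (q : Ht) : R[i] := conjc (ht_val q 1 0).

Lemma ht_abK (q : Ht) : ht (ht_a q) (ht_b q) = q.
Proof.
have /asboolP[a [b eq]] := ht_valP q.
by apply: val_inj; rewrite /= /ht_a /ht_b eq !mxE /= conjcK.
Qed.

Definition ht_star (q : Ht) : Ht := ht (conjc (ht_a q)) (- ht_b q).

Definition ht_normE (q : Ht) : R :=
  Num.sqrt (normc (ht_a q) ^+ 2 + `|t| * normc (ht_b q) ^+ 2).

(* The trace of an element of [Ht] is real (see [ht_trE]). *)
Definition ht_tr (q : Ht) : R := complex.Re (\tr (ht_val q)).

Lemma ht_trE (q : Ht) : \tr (ht_val q) = (ht_tr q)%:C.
Proof.
rewrite /ht_tr -(ht_abK q) /mxtrace big_ord_recl big_ord1 !mxE /=.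
by case: (ht_a q) => x y /=; simpc.
Qed.

(* Convergence in the finite-dimensional real space [Ht] is expressed with the
   norm [ht_normE]. *)
Definition ht_sum_to (u : nat -> Ht) (s : Ht) : Prop :=
  ht_normE (series u n - s) @[n --> \oo] --> (0 : R).

Definition ht_sum (u : nat -> Ht) : Ht := xget 0 [set s | ht_sum_to u s].

End HtMatrix.

(* [Ht t] as a right module over itself; right modules over [Ht t] are left
   modules over the converse ring. *)
Section HtRegular.
Context {R : realType} (t : R).

Let rscale (q : (Ht t)^c) (x : Ht t) : Ht t := x * (q : Ht t).

Let rscaleA p q x : rscale p (rscale q x) = rscale (p * q) x.
Proof. by rewrite /rscale -mulrA. Qed.
Let rscale1 : left_id 1 rscale.
Proof. by move=> x; rewrite /rscale mulr1. Qed.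
Let rscaleDr : right_distributive rscale +%R.
Proof. by move=> q x y; rewrite /rscale mulrDl. Qed.
Let rscaleDl x : {morph rscale^~ x : p q / p + q}.
Proof. by move=> p q; rewrite /rscale mulrDr. Qed.

HB.instance Definition _ := GRing.Zmodule_isLmodule.Build (Ht t)^c (Ht t)
  rscaleA rscale1 rscaleDr rscaleDl.
End HtRegular.

Definition ract {R : realType} {t : R} {V : lmodType (Ht t)^c}
  (v : V) (q : Ht t) : V := (q : (Ht t)^c) *: v.

Lemma ract_fctE {R : realType} {t : R} (T : Type) (f : T -> Ht t) (q : Ht t) :
  ract f q = (fun z => f z * q).
Proof. by []. Qed.

(* Restriction of scalars of a right [Ht t]-module along [r |-> r * 1]. *)
Definition realified {R : realType} {t : R} (V : lmodType (Ht t)^c) : Type := V.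

Section Realified.
Context {R : realType} (t : R) (V : lmodType (Ht t)^c).

HB.instance Definition _ := GRing.Zmodule.on (realified V).

Let ht_real (r : R) : (Ht t)^c := ht t r%:C 0.

Let ht_realD : {morph ht_real : r s / r + s}.
Proof.
move=> r s; apply: val_inj; apply/matrixP => i j; rewrite !mxE.
by case: eqP => _; case: eqP => _;
  rewrite ?conjc_real ?conjc0 ?mulr0 ?addr0 ?rmorphD.
Qed.

Let ht_real1 : ht_real 1 = 1.
Proof.
apply: val_inj; apply/matrixP => i j; rewrite !mxE mulr0 conjc0 conjc1.
by case: i j => [[|[|//]] ?] [[|[|//]] ?].
Qed.

Let ht_realM : {morph ht_real : r s / r * s}.
Proof.
move=> r s; apply: val_inj; apply/matrixP => i j.
rewrite !mxE big_ord_recl big_ord1 !mxE /=.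
case: eqP => _; case: eqP => _;
  rewrite ?conjc_real ?conjc0 ?mulr0 ?mul0r ?addr0 ?add0r //.
all: by simpc; rewrite ?oppr0 ?mulr0 ?mul0r ?addr0 ?subr0 ?(mulrC s).
Qed.

Let rscale (r : R) (v : realified V) : realified V := ht_real r *: (v : V).

Let rscaleA r s v : rscale r (rscale s v) = rscale (r * s) v.
Proof. by rewrite /rscale scalerA -ht_realM. Qed.
Let rscale1 : left_id 1 rscale.
Proof. by move=> v; rewrite /rscale ht_real1 scale1r. Qed.
Let rscaleDr : right_distributive rscale +%R.
Proof. by move=> r u v; rewrite /rscale scalerDr. Qed.
Let rscaleDl v : {morph rscale^~ v : r s / r + s}.
Proof. by move=> r s; rewrite /rscale ht_realD scalerDl. Qed.

HB.instance Definition _ := GRing.Zmodule_isLmodule.Build R (realified V)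
  rscaleA rscale1 rscaleDr rscaleDl.
End Realified.

(* Spaces are given as subsets [S] of an ambient real vector space, and only the
   values of the form [B] on [S] matter. *)
Section RealKrein.
Context {R : realType} {V : lmodType R}.
Implicit Types (S : set V) (B : V -> V -> R).

Definition real_subspace S : Prop :=
  S 0 /\ forall (r : R) u v, S u -> S v -> S (r *: u + v).

Definition sym_bilinear_on S B : Prop :=
  (forall (r : R) u v w, S u -> S v -> S w ->
     B (r *: u + v) w = r * B u w + B v w) /\
  (forall u v, S u -> S v -> B u v = B v u).

Definition indefinite_on S B : Prop :=
  (exists2 u, S u & 0 < B u u) /\ (exists2 v, S v & B v v < 0).

Definition pos_definite_on S B : Prop :=
  forall u, S u -> u <> 0 -> 0 < B u u.

Definition form_norm B (u : V) : R := Num.sqrt (B u u).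

Definition complete_on S B : Prop :=
  forall u : nat -> V, (forall n, S (u n)) ->
    (forall e : R, 0 < e -> exists N : nat, forall m n : nat,
       (N <= m)%N -> (N <= n)%N -> form_norm B (u m - u n) < e) ->
    exists2 l, S l & form_norm B (u n - l) @[n --> \oo] --> (0 : R).

Definition hilbert_space S B : Prop :=
  [/\ real_subspace S, sym_bilinear_on S B, pos_definite_on S B
    & complete_on S B].

Definition krein_space S B : Prop :=
  [/\ real_subspace S, sym_bilinear_on S B
    & exists Vp Vm : set V,
      [/\ hilbert_space Vp B,
          hilbert_space Vm (fun u v => - B u v),
          S = [set u + v | u in Vp & v in Vm],
          Vp `&` Vm = [set 0]
        & forall u v, Vp u -> Vm v -> B u v = 0]].

End RealKrein.

Section KreinModule.
Context {R : realType} {t : R}.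

Definition krein_module {V : lmodType (Ht t)^c} (K : set V)
    (form : V -> V -> Ht t) : Prop :=
  [/\ [/\ K 0, (forall u v, K u -> K v -> K (u + v))
        & forall v q, K v -> K (ract v q)],
      (forall u v w, K u -> K v -> K w ->
         form (u + v) w = form u w + form v w /\
         form w (u + v) = form w u + form w v),
      (forall v w p q, K v -> K w ->
         form (ract v q) (ract w p) = ht_star p * form v w * q)
    & krein_space (V := realified V) K (fun v w => ht_tr (form v w))].

Definition rk_krein_module {Omega : Type} (K : set (Omega -> Ht t))
    (form : (Omega -> Ht t) -> (Omega -> Ht t) -> Ht t)
    (k : Omega -> Omega -> Ht t) : Prop :=
  [/\ krein_module K form,
      (forall w b, K (ract (k^~ w) b))
    & forall f w b, K f ->
        ht_tr (form f (ract (k^~ w) b)) = ht_tr (ht_star b * f w)].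

End KreinModule.

Section Hardy.
Context {R : realType} (t : R).

Definition cvec_norm (v : 'cV[R[i]]_2) : R :=
  Num.sqrt (\sum_i normc (v i 0) ^+ 2).

Definition op_norm (M : 'M[R[i]]_2) : R :=
  sup [set cvec_norm (M *m v) | v in [set v | cvec_norm v <= 1]].

Definition Omega : Type := {q : Ht t | op_norm q < 1}.

Definition square_summable (alpha : nat -> Ht t) : Prop :=
  cvgn (series (fun n => ht_normE (alpha n) ^+ 2)).

Definition power_series (alpha : nat -> Ht t) : Omega -> Ht t :=
  fun q => ht_sum (fun n => val q ^+ n * alpha n).

Definition hardy : set (Omega -> Ht t) :=
  [set power_series alpha | alpha in square_summable].

(* The square summable coefficient sequence of [f] is unique when it exists,
   because [Omega] contains the real scalars of absolute value less than 1. *)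
Definition hardy_coef (f : Omega -> Ht t) : nat -> Ht t :=
  xget (fun=> 0) [set alpha | square_summable alpha /\ power_series alpha = f].

Definition hardy_form (f g : Omega -> Ht t) : Ht t :=
  ht_sum (fun n => ht_star (hardy_coef g n) * hardy_coef f n).

Definition hardy_kernel (q p : Omega) : Ht t :=
  ht_sum (fun n => val q ^+ n * ht_star (val p) ^+ n).

End Hardy.

Arguments hardy {R} t _.
Arguments hardy_form {R} t f g.
Arguments hardy_kernel {R} t q p.

(* Main.v *)
Require Import Defs.
From mathcomp Require Import all_boot all_order all_algebra.
From mathcomp Require Import complex ring lra.
From mathcomp Require Import all_classical all_reals all_analysis.
Import Order.TTheory GRing.Theory Num.Theory.
Import numFieldNormedType.Exports.
Local Open Scope classical_set_scope.
Local Open Scope ring_scope.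

(** The coefficients of a square summable series are determined by its values
    at real scalars, so the Hardy module is the space of square summable
    sequences in [Ht t].  For q = (a, b) one has
    Tr (star q * q) = 2 (|a|^2 - t |b|^2).  If t > 0, the sequences with b = 0
    and those with a = 0 form the positive and the negative summand, on which
    the trace form is twice plus or minus the l^2 inner product; if t < 0, the
    whole space is positive.  The reproducing property is the identity
    star (star w ^ n * x) * alpha_n = star x * (w ^ n * alpha_n), summed over n;
    the kernel lies in the module because the operator norm bound gives
    geometric decay of w ^ n, and star preserves the Euclidean norm. *)

(** * The algebra [Ht t] and its Euclidean norm *)

Section HtNorm.
Context {R : realType} {t : R}.
Implicit Types (p q x y : Ht t) (r : R).

(** The same embedding of the reals defines the scalar action on [realified], so real scaling of a
    function is right multiplication by [ht_of_real r]. *)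
Definition ht_of_real r : Ht t := ht t r%:C%C 0.

Lemma ht_aE (a b : R[i]) : ht_a (ht t a b) = a.
Proof. by rewrite /ht_a /= mxE. Qed.

Lemma ht_bE (a b : R[i]) : ht_b (ht t a b) = b.
Proof. by rewrite /ht_b /= mxE /= conjcK. Qed.

Lemma ht_ext x y : ht_a x = ht_a y -> ht_b x = ht_b y -> x = y.
Proof. by move=> ea eb; rewrite -(ht_abK x) -(ht_abK y) ea eb. Qed.

Lemma ht_aB x y : ht_a (x - y) = ht_a x - ht_a y.
Proof. by rewrite /ht_a /= !mxE. Qed.

Lemma ht_bB x y : ht_b (x - y) = ht_b x - ht_b y.
Proof. by rewrite /ht_b /= !mxE rmorphB. Qed.

Lemma ht_a0 : ht_a (0 : Ht t) = 0.
Proof. by rewrite /ht_a /= mxE. Qed.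

Lemma ht_b0 : ht_b (0 : Ht t) = 0.
Proof. by rewrite /ht_b /= mxE conjc0. Qed.

Lemma ht_aD x y : ht_a (x + y) = ht_a x + ht_a y.
Proof. by rewrite /ht_a /= !mxE. Qed.

Lemma ht_bD x y : ht_b (x + y) = ht_b x + ht_b y.
Proof. by rewrite /ht_b /= !mxE rmorphD. Qed.

Lemma ht_aN x : ht_a (- x) = - ht_a x.
Proof. by rewrite -[- x]add0r ht_aB ht_a0 sub0r. Qed.

Lemma ht_bN x : ht_b (- x) = - ht_b x.
Proof. by rewrite -[- x]add0r ht_bB ht_b0 sub0r. Qed.

Lemma ht_aM x y :
  ht_a (x * y) = ht_a x * ht_a y + t%:C%C * ht_b x * conjc (ht_b y).
Proof.
rewrite -{1}(ht_abK x) -{1}(ht_abK y) /ht_a /= !mxE big_ord_recl big_ord1.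
by rewrite !mxE.
Qed.

Lemma ht_bM x y :
  ht_b (x * y) = ht_a x * ht_b y + ht_b x * conjc (ht_a y).
Proof.
rewrite -{1}(ht_abK x) -{1}(ht_abK y) /ht_b /= !mxE big_ord_recl big_ord1.
by rewrite !mxE /= !conjcK rmorphD !rmorphM /= !conjcK addrC.
Qed.

Lemma ht_a1 : ht_a (1 : Ht t) = 1.
Proof. by rewrite /ht_a /= mxE. Qed.

Lemma ht_b1 : ht_b (1 : Ht t) = 0.
Proof. by rewrite /ht_b /= mxE conjc0. Qed.

Lemma ht_of_realM x r :
  x * ht_of_real r = ht t (ht_a x * r%:C%C) (ht_b x * r%:C%C).
Proof.
apply: ht_ext.
  by rewrite ht_aM !ht_aE ht_bE conjc0 mulr0 addr0.
by rewrite ht_bM !ht_bE ht_aE mulr0 add0r conjc_real.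
Qed.

Lemma ht_of_real_comm x r : ht_of_real r * x = x * ht_of_real r.
Proof.
rewrite ht_of_realM; apply: ht_ext.
  by rewrite ht_aM !ht_aE ht_bE mulr0 mul0r addr0 mulrC.
by rewrite ht_bM !ht_bE ht_aE mul0r addr0 mulrC.
Qed.

Lemma ht_of_realXn r n : ht_of_real r ^+ n = ht_of_real (r ^+ n).
Proof.
elim: n => [|n IH].
  by rewrite !expr0; apply: ht_ext; rewrite ?ht_aE ?ht_bE ?ht_a1 ?ht_b1.
rewrite exprSr IH ht_of_realM; apply: ht_ext; rewrite ?ht_aE ?ht_bE.
  by rewrite -rmorphM exprSr.
by rewrite mul0r.
Qed.

Lemma ht_starM x y : ht_star (x * y) = ht_star y * ht_star x.
Proof.
have cD (z w : R[i]) : conjc (z + w) = conjc z + conjc w by exact: rmorphD.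
have cM (z w : R[i]) : conjc (z * w) = conjc z * conjc w by exact: rmorphM.
have cN (z : R[i]) : conjc (- z) = - conjc z by exact: rmorphN.
apply: ht_ext.
  rewrite ht_aE !ht_aM !ht_aE !ht_bE cD !cM cN conjc_real (conjcK (ht_b y)).
  by ring.
by rewrite ht_bE !ht_bM !ht_aE !ht_bE (conjcK (ht_a x)); ring.
Qed.

Lemma ht_starK : involutive (@ht_star R t).
Proof.
by move=> x; apply: ht_ext; rewrite ?ht_aE ?ht_bE ?ht_aE ?ht_bE ?(conjcK (ht_a _)) ?opprK.
Qed.

Lemma ht_starD x y : ht_star (x + y) = ht_star x + ht_star y.
Proof.
apply: ht_ext; first by rewrite ht_aE !ht_aD !ht_aE rmorphD.
by rewrite ht_bE !ht_bD !ht_bE opprD.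
Qed.

Lemma ht_starXn x n : ht_star (x ^+ n) = ht_star x ^+ n.
Proof.
elim: n => [|n IH]; last by rewrite exprS exprSr ht_starM IH.
rewrite !expr0; apply: ht_ext; rewrite ?ht_aE ?ht_bE ?ht_a1 ?ht_b1.
  exact: conjc1.
exact: oppr0.
Qed.

Lemma normc_sqr (z : R[i]) :
  Normc.normc z ^+ 2 = complex.Re z ^+ 2 + complex.Im z ^+ 2.
Proof. by case: z => u v; rewrite sqr_sqrtr ?addr_ge0 ?sqr_ge0. Qed.

Lemma normc_ge0 (z : R[i]) : 0 <= Normc.normc z.
Proof. by case: z => u v; rewrite sqrtr_ge0. Qed.

Lemma normc_real r : Normc.normc r%:C%C = `|r|.
Proof. by rewrite /= expr0n addr0 sqrtr_sqr. Qed.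

Lemma normc_conj (z : R[i]) : Normc.normc (conjc z) = Normc.normc z.
Proof. by case: z => u v /=; rewrite sqrrN. Qed.

Lemma ht_normE_ge0 x : 0 <= ht_normE x.
Proof. exact: sqrtr_ge0. Qed.

Lemma normr_sqr_ge0 r : 0 <= `|t| * r ^+ 2.
Proof. exact: mulr_ge0 (normr_ge0 _) (sqr_ge0 _). Qed.

Lemma ht_normE_sqr x : ht_normE x ^+ 2 =
  Normc.normc (ht_a x) ^+ 2 + `|t| * Normc.normc (ht_b x) ^+ 2.
Proof. exact/sqr_sqrtr/addr_ge0/normr_sqr_ge0/sqr_ge0. Qed.

Lemma ht_normE0 : ht_normE (0 : Ht t) = 0.
Proof.
by rewrite /ht_normE ht_a0 ht_b0 Normc.normc0 expr0n mulr0 addr0 sqrtr0.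
Qed.

Lemma ht_normE_star x : ht_normE (ht_star x) = ht_normE x.
Proof.
by rewrite /ht_normE ht_aE ht_bE normc_conj normcN.
Qed.

Lemma ht_normEN x : ht_normE (- x) = ht_normE x.
Proof.
by rewrite /ht_normE ht_aN ht_bN !normcN.
Qed.

(** For t = 0 the norm would be blind to the [ht_b] component, and neither limits nor coefficients
    would be unique. *)
Lemma ht_normE_eq0 (t_neq0 : t != 0) x : ht_normE x = 0 -> x = 0.
Proof.
move=> /(congr1 (fun r => r ^+ 2)); rewrite ht_normE_sqr expr0n /= => /eqP.
rewrite paddr_eq0 ?sqr_ge0 ?normr_sqr_ge0//.
rewrite (mulf_eq0 `|t|) normr_eq0 (negPf t_neq0) /=.
rewrite !sqrf_eq0 => /andP[/eqP a0 /eqP b0].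
by apply: ht_ext; rewrite ?ht_a0 ?ht_b0; apply: Normc.eq0_normc.
Qed.

Lemma ht_normE_real x r : ht_normE (x * ht_of_real r) = `|r| * ht_normE x.
Proof.
apply/eqP; rewrite -(@eqrXn2 _ 2) ?mulr_ge0 ?ht_normE_ge0//; apply/eqP.
rewrite exprMn !ht_normE_sqr ht_of_realM ht_aE ht_bE !Normc.normcM !exprMn.
by rewrite !(normc_sqr r%:C%C) /= expr0n addr0 real_normK ?num_real//; ring.
Qed.

(* Cauchy-Schwarz with weights 1, 1, T, T, from Lagrange's identity. *)
Lemma ht_normED x y : ht_normE (x + y) <= ht_normE x + ht_normE y.
Proof.
rewrite -(@ler_pXn2r _ 2) ?nnegrE ?addr_ge0 ?ht_normE_ge0//.
have CS (T : R) : 0 <= T -> forall x0 x1 x2 x3 y0 y1 y2 y3 X Y : R,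
   0 <= X -> 0 <= Y ->
   X ^+ 2 = (x0 ^+ 2 + x1 ^+ 2) + T * (x2 ^+ 2 + x3 ^+ 2) ->
   Y ^+ 2 = (y0 ^+ 2 + y1 ^+ 2) + T * (y2 ^+ 2 + y3 ^+ 2) ->
   x0 * y0 + x1 * y1 + T * (x2 * y2 + x3 * y3) <= X * Y.
  move=> T0 x0 x1 x2 x3 y0 y1 y2 y3 X Y X0 Y0 EX EY.
  set z := (X in X <= _); have [z0|/ltW z0] := leP z 0.
    by rewrite (le_trans z0)// mulr_ge0.
  rewrite -(@ler_pXn2r _ 2) ?nnegrE ?mulr_ge0// exprMn EX EY -subr_ge0 /z.
  set D := (X in 0 <= X).
  have -> : D = (x0 * y1 - x1 * y0) ^+ 2
     + T * ((x0 * y2 - x2 * y0) ^+ 2 + (x0 * y3 - x3 * y0) ^+ 2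
          + (x1 * y2 - x2 * y1) ^+ 2 + (x1 * y3 - x3 * y1) ^+ 2)
     + T ^+ 2 * (x2 * y3 - x3 * y2) ^+ 2 by rewrite /D; ring.
  by rewrite !(sqr_ge0, addr_ge0, mulr_ge0).
rewrite sqrrD !ht_normE_sqr ht_aD ht_bD !normc_sqr.
have := CS `|t| (normr_ge0 _) _ _ _ _ _ _ _ _ _ _ (ht_normE_ge0 x)
  (ht_normE_ge0 y) _ _.
rewrite !ht_normE_sqr !normc_sqr => /(_ _ _ _ _ _ _ _ _ erefl erefl).
rewrite !raddfD /=.
move: (ht_normE x * ht_normE y) => N.
by move: `|t| => T H; rewrite -subr_ge0; move: H; rewrite -subr_ge0; lra.
Qed.

Lemma ht_normE_subC x y : ht_normE (x - y) = ht_normE (y - x).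
Proof. by rewrite -ht_normEN opprB. Qed.

Lemma ht_normED_sqr x y :
  ht_normE (x + y) ^+ 2 <= 2 * (ht_normE x ^+ 2 + ht_normE y ^+ 2).
Proof.
have := ht_normED x y; rewrite -(@ler_pXn2r _ 2) ?nnegrE ?addr_ge0 ?ht_normE_ge0//.
by have := sqr_ge0 (ht_normE x - ht_normE y); lra.
Qed.

Lemma ht_normE_sum (I : Type) (s : seq I) (P : pred I) (F : I -> Ht t) :
  ht_normE (\sum_(i <- s | P i) F i) <= \sum_(i <- s | P i) ht_normE (F i).
Proof.
elim/big_ind2: _ => [|x r y r' xr yr'|//]; first by rewrite ht_normE0.
by rewrite (le_trans (ht_normED _ _))// lerD.
Qed.

(** This and the next two bounds make the Euclidean norm equivalent to |a| + sqrt |t| |b|, which is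
    easier to multiply and to control coordinatewise. *)
Lemma normc_a_le x : Normc.normc (ht_a x) <= ht_normE x.
Proof.
rewrite -(@ler_pXn2r _ 2) ?nnegrE ?ht_normE_ge0 ?normc_ge0// ht_normE_sqr.
by rewrite lerDl mulr_ge0 ?sqr_ge0.
Qed.

Lemma normc_b_le x : Num.sqrt `|t| * Normc.normc (ht_b x) <= ht_normE x.
Proof.
rewrite -(@ler_pXn2r _ 2) ?nnegrE ?mulr_ge0 ?ht_normE_ge0 ?normc_ge0//.
by rewrite ht_normE_sqr exprMn sqr_sqrtr// lerDr sqr_ge0.
Qed.

Lemma ht_normE_le x : ht_normE x <=
  Normc.normc (ht_a x) + Num.sqrt `|t| * Normc.normc (ht_b x).
Proof.
rewrite -(@ler_pXn2r _ 2) ?nnegrE ?addr_ge0 ?mulr_ge0 ?ht_normE_ge0 ?normc_ge0//.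
rewrite ht_normE_sqr sqrrD exprMn sqr_sqrtr// lerD2r lerDl mulrn_wge0//.
by rewrite !mulr_ge0 ?normc_ge0.
Qed.

(** The weighted sum |a| + sqrt |t| |b| is submultiplicative, dominates the norm and is at most
    twice it, whence the constant 2 * 2. Only the continuity of multiplication matters later. *)
Lemma ht_normEM x y : ht_normE (x * y) <= 4 * (ht_normE x * ht_normE y).
Proof.
have ab_le (z : Ht t) : Normc.normc (ht_a z) + Num.sqrt `|t| * Normc.normc (ht_b z)
    <= 2 * ht_normE z.
  by move: (normc_a_le z) (normc_b_le z); lra.
have ab_ge0 (z : Ht t) :
    0 <= Normc.normc (ht_a z) + Num.sqrt `|t| * Normc.normc (ht_b z).
  exact: addr_ge0 (normc_ge0 _) (mulr_ge0 (sqrtr_ge0 _) (normc_ge0 _)).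
have := ler_pM (ab_ge0 x) (ab_ge0 y) (ab_le x) (ab_le y).
rewrite (_ : 2 * _ * _ = 4 * (ht_normE x * ht_normE y)); last by ring.
apply: le_trans; rewrite (le_trans (ht_normE_le _))// ht_aM ht_bM.
have D1 := le_normcD (ht_a x * ht_a y) (t%:C%C * ht_b x * conjc (ht_b y)).
have D2 := le_normcD (ht_a x * ht_b y) (ht_b x * conjc (ht_a y)).
rewrite (le_trans (lerD D1 (ler_wpM2l (sqrtr_ge0 _) D2)))//.
rewrite !Normc.normcM !normc_conj normc_real -{1}(@sqr_sqrtr _ `|t|)//.
by rewrite le_eqVlt; apply/orP; left; apply/eqP; ring.
Qed.

End HtNorm.

(** * Completeness of [Ht t] *)

Lemma cvg0_squeeze {R : realType} (u v : nat -> R) (k : R) :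
  (forall n, `|u n| <= k * v n) -> v @ \oo --> 0 -> u @ \oo --> 0.
Proof.
move=> uv v0; apply/norm_cvg0P.
have kv0 : (fun n => k * v n) @ \oo --> 0.
  by rewrite -(mulr0 k); apply: cvgMr.
apply: (squeeze_cvgr _ (cvg_cst 0) kv0).
by apply: nearW => n; rewrite normr_ge0 uv.
Qed.

Lemma normc_le {R : realType} (z : R[i]) :
  Normc.normc z <= `|complex.Re z| + `|complex.Im z|.
Proof.
rewrite -(@ler_pXn2r _ 2) ?nnegrE ?addr_ge0 ?normc_ge0//.
rewrite normc_sqr sqrrD !real_normK ?num_real// lerD2r lerDl.
exact/mulrn_wge0/mulr_ge0.

Qed.

Lemma normr_Re_le {R : realType} (z : R[i]) : `|complex.Re z| <= Normc.normc z.
Proof.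
rewrite -(@ler_pXn2r _ 2) ?nnegrE ?normc_ge0//.
by rewrite normc_sqr real_normK ?num_real// lerDl sqr_ge0.
Qed.

Lemma normr_Im_le {R : realType} (z : R[i]) : `|complex.Im z| <= Normc.normc z.
Proof.
rewrite -(@ler_pXn2r _ 2) ?nnegrE ?normc_ge0//.
by rewrite normc_sqr real_normK ?num_real// lerDr sqr_ge0.
Qed.

(** * The trace on a single element of the algebra *)

Section HtTrace.
Context {R : realType} {t : R}.
Implicit Types (p q x y : Ht t) (r : R).

Lemma ht_tr_a x : ht_tr x = 2 * complex.Re (ht_a x).
Proof.
rewrite /ht_tr -{1}(ht_abK x) /mxtrace big_ord_recl big_ord1 !mxE /=.
by case: (ht_a x) => u v /=; ring.
Qed.

Lemma ht_trD x y : ht_tr (x + y) = ht_tr x + ht_tr y.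
Proof. by rewrite !ht_tr_a ht_aD raddfD /= mulrDr. Qed.

Lemma ht_trB x y : ht_tr (x - y) = ht_tr x - ht_tr y.
Proof. by rewrite !ht_tr_a ht_aB raddfB /= mulrBr. Qed.

Lemma ht_tr0 : ht_tr (0 : Ht t) = 0.
Proof. by rewrite ht_tr_a ht_a0 mulr0. Qed.

Lemma ht_tr_star x : ht_tr (ht_star x) = ht_tr x.
Proof. by rewrite !ht_tr_a ht_aE; case: (ht_a x). Qed.

Lemma ht_tr_starM_sym x y : ht_tr (ht_star x * y) = ht_tr (ht_star y * x).
Proof. by rewrite -ht_tr_star ht_starM ht_starK. Qed.

Lemma ht_tr_of_realM x r : ht_tr (x * ht_of_real r) = r * ht_tr x.
Proof.
rewrite ht_of_realM !ht_tr_a ht_aE.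
by case: (ht_a x) => u v /=; ring.
Qed.

(** The [ht_a] and [ht_b] components contribute separately, so elements with a = 0 are orthogonal to
    elements with b = 0. *)
Lemma ht_tr_starM x y : ht_tr (ht_star x * y) =
  2 * (complex.Re (conjc (ht_a x) * ht_a y)
       - t * complex.Re (conjc (ht_b y) * ht_b x)).
Proof.
rewrite ht_tr_a ht_aM ht_aE ht_bE; congr (2 * _); rewrite raddfD /=.
by congr (_ + _); case: (ht_b x) (ht_b y) => ? ? [? ?] /=; ring.
Qed.

Lemma ht_tr_starMM x : ht_tr (ht_star x * x) =
  2 * (Normc.normc (ht_a x) ^+ 2 - t * Normc.normc (ht_b x) ^+ 2).
Proof.
rewrite ht_tr_starM !normc_sqr.
by case: (ht_a x) (ht_b x) => ? ? [? ?] /=; ring.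
Qed.

Lemma normr_ht_tr_le x : `|ht_tr x| <= 2 * ht_normE x.
Proof.
rewrite ht_tr_a normrM ger0_norm// ler_wpM2l//.
by rewrite (le_trans (normr_Re_le _))// normc_a_le.
Qed.

End HtTrace.

(** * Limits in [Ht t] and completeness *)

Section HtConvergence.
Context {R : realType} {t : R}.
Implicit Types (x y : Ht t) (u v : nat -> Ht t).

Definition ht_cvg u x : Prop := ht_normE (u n - x) @[n --> \oo] --> (0 : R).

(** An additive map with a linear norm bound is continuous. Left and right multiplication are
    instances of this lemma, the trace and the real coordinates of its real-valued analogue. *)
Lemma ht_cvg_additive (f : Ht t -> Ht t) (k : R) u x :
  {morph f : a b / a - b} -> (forall a, ht_normE (f a) <= k * ht_normE a) ->
  ht_cvg u x -> ht_cvg (f \o u) (f x).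
Proof.
move=> fB fk; apply: (@cvg0_squeeze _ _ _ k) => n.
by rewrite /= -fB ger0_norm ?ht_normE_ge0.
Qed.

Lemma ht_cvg_functional (f : Ht t -> R) (k : R) u x :
  {morph f : a b / a - b} -> (forall a, `|f a| <= k * ht_normE a) ->
  ht_cvg u x -> f \o u @ \oo --> f x.
Proof.
move=> fB fk ux; apply/subr_cvg0; move: ux.
by apply: (@cvg0_squeeze _ _ _ k) => n; rewrite /= -fB.
Qed.

Lemma ht_cvgD u v x y :
  ht_cvg u x -> ht_cvg v y -> ht_cvg (fun n => u n + v n) (x + y).
Proof.
move=> ux vy.
have uv0 : ht_normE (u n - x) + ht_normE (v n - y) @[n --> \oo] --> (0 : R).
  by rewrite -(addr0 0); apply: cvgD.
apply: (@cvg0_squeeze _ _ _ 1 _ uv0) => n.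
by rewrite mul1r ger0_norm ?ht_normE_ge0// opprD addrACA ht_normED.
Qed.

(** By the reverse triangle inequality. This continuity of the norm lets estimates on partial sums
    or on Cauchy differences pass to the limit. *)
Lemma ht_cvg_normE_subl u x y :
  ht_cvg u x -> ht_normE (y - u n) @[n --> \oo] --> ht_normE (y - x).
Proof.
move=> ux; apply/subr_cvg0; move: ux.
apply: (@cvg0_squeeze _ _ _ 1) => n; rewrite mul1r ler_norml.
have := ht_normED (y - u n) (u n - x); have := ht_normED (y - x) (x - u n).
rewrite !addrA !subrK (ht_normE_subC x (u n)); lra.
Qed.

Lemma ht_cvg_unique (t_neq0 : t != 0) u x y : ht_cvg u x -> ht_cvg u y -> x = y.
Proof.
move=> ux uy; apply/eqP; rewrite -subr_eq0; apply/eqP/(ht_normE_eq0 t_neq0).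
have := ht_cvg_normE_subl u y x uy; under eq_fun do rewrite ht_normE_subC.
by move=> xy; apply: (cvg_unique (@Rhausdorff R) xy ux).
Qed.

Lemma functional_cauchy_cvg (f : Ht t -> R) (k : R) u :
  {morph f : a b / a - b} -> 0 < k -> (forall a, `|f a| <= k * ht_normE a) ->
  (forall e : R, 0 < e -> exists N : nat, forall m n : nat,
     (N <= m)%N -> (N <= n)%N -> ht_normE (u m - u n) < e) ->
  cvgn (f \o u).
Proof.
move=> fB k0 fk uC; apply/cauchy_cvgP/cauchy_exP => e e0.
have [N uN] := uC (e / k) (divr_gt0 e0 k0).
exists (f (u N)); exists N => // n /= Nn.
rewrite /ball /= -fB (le_lt_trans (fk _))// mulrC -ltr_pdivlMr//.
exact: uN.
Qed.

(** The four real coordinates are bounded functionals, those of b with constant 1 / sqrt |t|, so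
    each converges by completeness of the reals. Conversely the norm is at most a weighted sum of
    the coordinates, so the coordinatewise limit is a limit in norm. *)
Lemma ht_complete (t_neq0 : t != 0) u :
  (forall e : R, 0 < e -> exists N : nat, forall m n : nat,
     (N <= m)%N -> (N <= n)%N -> ht_normE (u m - u n) < e) ->
  exists x, ht_cvg u x.
Proof.
move=> uC; set s := Num.sqrt `|t|.
have s0 : 0 < s by rewrite sqrtr_gt0 normr_gt0.
have sV0 : 0 < s^-1 by rewrite invr_gt0.
pose ra (x : Ht t) := complex.Re (ht_a x).
pose ia (x : Ht t) := complex.Im (ht_a x).
pose rb (x : Ht t) := complex.Re (ht_b x).
pose ib (x : Ht t) := complex.Im (ht_b x).
have raB : {morph ra : x y / x - y} by move=> x y; rewrite /ra ht_aB raddfB.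
have iaB : {morph ia : x y / x - y} by move=> x y; rewrite /ia ht_aB raddfB.
have rbB : {morph rb : x y / x - y} by move=> x y; rewrite /rb ht_bB raddfB.
have ibB : {morph ib : x y / x - y} by move=> x y; rewrite /ib ht_bB raddfB.
have raC : cvgn (ra \o u).
  apply: (functional_cauchy_cvg _ 1) => // x; rewrite mul1r.
  exact: le_trans (normr_Re_le _) (normc_a_le _).
have iaC : cvgn (ia \o u).
  apply: (functional_cauchy_cvg _ 1) => // x; rewrite mul1r.
  exact: le_trans (normr_Im_le _) (normc_a_le _).
have bk (x : Ht t) : Normc.normc (ht_b x) <= s^-1 * ht_normE x.
  by rewrite mulrC ler_pdivlMr// mulrC normc_b_le.
have rbC : cvgn (rb \o u).
  apply: (functional_cauchy_cvg _ s^-1) => // x.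
  exact: le_trans (normr_Re_le _) (bk _).
have ibC : cvgn (ib \o u).
  apply: (functional_cauchy_cvg _ s^-1) => // x.
  exact: le_trans (normr_Im_le _) (bk _).
pose x : Ht t := ht t (Complex (limn (ra \o u)) (limn (ia \o u)))
  (Complex (limn (rb \o u)) (limn (ib \o u))).
exists x.
have to0 (f : Ht t -> R) : {morph f : x y / x - y} -> cvgn (f \o u) ->
    f x = limn (f \o u) -> `|f (u n - x)| @[n --> \oo] --> (0 : R).
  move=> fB fc fx; apply/norm_cvg0P.
  by under eq_fun do rewrite fB fx; apply/subr_cvg0.
have H : `|ra (u n - x)| + `|ia (u n - x)| + s * (`|rb (u n - x)| +
    `|ib (u n - x)|) @[n --> \oo] --> (0 : R).
  rewrite -(addr0 0); apply: cvgD.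
    by rewrite -(addr0 0); apply: cvgD; apply: to0; rewrite // /ra /ia ht_aE.
  rewrite -(mulr0 s); apply: cvgMr; rewrite -(addr0 0).
  by apply: cvgD; apply: to0; rewrite // /rb /ib ht_bE.
apply: (@cvg0_squeeze _ _ _ 1 _ H) => n.
rewrite mul1r ger0_norm ?ht_normE_ge0// (le_trans (ht_normE_le _))//.
by rewrite lerD ?ler_wpM2l ?normc_le// ltW.
Qed.

End HtConvergence.

(** * Series in [Ht t] *)

Lemma additive_series {U V : zmodType} (f : U -> V) (u : nat -> U) (n : nat) :
  {morph f : x y / x - y} -> f (series u n) = series (f \o u) n.
Proof.
move=> fB; have f0 : f 0 = 0 by rewrite -[0 in LHS](subrr 0) fB subrr.
have fD x y : f (x + y) = f x + f y.
  by rewrite -[y in LHS]opprK -[- y]sub0r !fB f0 sub0r opprK.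
exact: (big_morph f fD f0).
Qed.

Lemma series_nneg_le_lim {R : realType} (u : nat -> R) (n : nat) :
  (forall k, 0 <= u k) -> cvgn (series u) -> series u n <= limn (series u).
Proof.
by move=> u0 uc; apply: nondecreasing_cvgn_le => //; apply: nondecreasing_series.
Qed.

Lemma nneg_le_lim_series {R : realType} (u : nat -> R) (n : nat) :
  (forall k, 0 <= u k) -> cvgn (series u) -> u n <= limn (series u).
Proof.
move=> u0 uc; apply: le_trans (series_nneg_le_lim u n.+1 u0 uc).
by rewrite seriesSr lerDr sumr_ge0.
Qed.

Lemma is_cvg_series_scale {R : realType} (u : nat -> R) (k : R) :
  cvgn (series u) -> cvgn (series (fun n => k * u n)).
Proof. exact: is_cvg_seriesZ. Qed.

Section HtSums.
Context {R : realType} {t : R}.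
Implicit Types (u v alpha beta : nat -> Ht t) (x y : Ht t).

Lemma ht_sum_to_additive (f : Ht t -> Ht t) (k : R) u x :
  {morph f : a b / a - b} -> (forall a, ht_normE (f a) <= k * ht_normE a) ->
  ht_sum_to u x -> ht_sum_to (f \o u) (f x).
Proof.
move=> fB fk /(ht_cvg_additive f k _ _ fB fk); rewrite /ht_cvg.
by under eq_fun do rewrite /= additive_series//.
Qed.

Lemma ht_sum_to_functional (f : Ht t -> R) (k : R) u x :
  {morph f : a b / a - b} -> (forall a, `|f a| <= k * ht_normE a) ->
  ht_sum_to u x -> series (f \o u) @ \oo --> f x.
Proof.
move=> fB fk /(ht_cvg_functional f k _ _ fB fk).
suff -> : f \o series u = series (f \o u) by [].
by apply/funext => n /=; rewrite additive_series.
Qed.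

Lemma ht_sum_toD u v x y :
  ht_sum_to u x -> ht_sum_to v y -> ht_sum_to (fun n => u n + v n) (x + y).
Proof.
move=> ux vy; have := ht_cvgD _ _ _ _ ux vy; rewrite /ht_cvg.
by under eq_fun do rewrite -big_split.
Qed.

Lemma ht_sum_toMl u x y : ht_sum_to u x -> ht_sum_to (fun n => y * u n) (y * x).
Proof.
apply: (ht_sum_to_additive ( *%R y) (4 * ht_normE y)) => [a b|a].
  by rewrite mulrBr.
by rewrite -mulrA ht_normEM.
Qed.

Lemma ht_sum_toMr u x y : ht_sum_to u x -> ht_sum_to (fun n => u n * y) (x * y).
Proof.
apply: (ht_sum_to_additive ( *%R^~ y) (4 * ht_normE y)) => [a b|a].
  by rewrite mulrBl.
by rewrite -mulrA (mulrC (ht_normE y)) ht_normEM.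
Qed.

Lemma ht_sum_to_tr u x :
  ht_sum_to u x -> series (fun n => ht_tr (u n)) @ \oo --> ht_tr x.
Proof.
apply: (ht_sum_to_functional (@ht_tr R t) 2); last exact: normr_ht_tr_le.
exact: ht_trB.
Qed.

Lemma square_summable_le (w : nat -> R) alpha :
  (forall n, ht_normE (alpha n) ^+ 2 <= w n) -> cvgn (series w) ->
  square_summable alpha.
Proof.
move=> aw wc; apply: (series_le_cvg _ _ aw wc) => n; first exact: sqr_ge0.
exact: le_trans (sqr_ge0 _) (aw n).
Qed.

Lemma square_summable_bounded_by (k : R) alpha beta :
  (forall n, ht_normE (alpha n) <= k * ht_normE (beta n)) ->
  square_summable beta -> square_summable alpha.
Proof.
move=> ab bs; apply: (square_summable_le
  (fun n => k ^+ 2 * ht_normE (beta n) ^+ 2)) => [n|].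
  have := ab n; rewrite -(@ler_pXn2r _ 2) ?nnegrE ?ht_normE_ge0//.
    by rewrite exprMn.
  exact: le_trans (ht_normE_ge0 _) (ab n).
exact: is_cvg_series_scale.
Qed.

Lemma square_summable0 : square_summable (fun=> 0 : Ht t).
Proof.
rewrite /square_summable (_ : series _ = cst 0); first exact: is_cvg_cst.
by apply/funext => n; rewrite /series /= big1// => k _; rewrite ht_normE0 expr0n.
Qed.

Lemma square_summableD alpha beta :
  square_summable alpha -> square_summable beta ->
  square_summable (fun n => alpha n + beta n).
Proof.
move=> sa sb; apply: (square_summable_le (fun n => 2 *
   (ht_normE (alpha n) ^+ 2 + ht_normE (beta n) ^+ 2))) => [n|].
  exact: ht_normED_sqr.
apply: is_cvg_series_scale.
exact: (is_cvg_seriesD sa sb).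
Qed.

Lemma square_summableMr alpha x :
  square_summable alpha -> square_summable (fun n => alpha n * x).
Proof.
apply: (square_summable_bounded_by (4 * ht_normE x)) => n.
by rewrite -mulrA (mulrC (ht_normE x)) ht_normEM.
Qed.

Lemma square_summable_star alpha :
  square_summable alpha -> square_summable (fun n => ht_star (alpha n)).
Proof.
by apply: (square_summable_bounded_by 1) => n; rewrite mul1r ht_normE_star.
Qed.

Lemma square_summableB alpha beta :
  square_summable alpha -> square_summable beta ->
  square_summable (fun n => alpha n - beta n).
Proof.
move=> sa sb; apply: (square_summableD _ _ sa).
by apply: (square_summable_bounded_by 1 _ _ _ sb) => n; rewrite mul1r ht_normEN.
Qed.

Lemma square_summable_bounded alpha : square_summable alpha ->
  exists M : R, forall n, ht_normE (alpha n) <= M.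
Proof.
move=> sa; exists (Num.sqrt (limn (series (fun n => ht_normE (alpha n) ^+ 2)))).
move=> n; rewrite -[leLHS]ger0_norm ?ht_normE_ge0// -sqrtr_sqr ler_wsqrtr//.
by apply: (nneg_le_lim_series (fun n => ht_normE (alpha n) ^+ 2)) => // k;
  apply: sqr_ge0.
Qed.

Hypothesis t_neq0 : t != 0.

(** [ht_sum] picks some limit by [xget]; uniqueness of limits identifies it. *)
Lemma ht_sumE u x : ht_sum_to u x -> ht_sum u = x.
Proof.
move=> ux; apply: (ht_cvg_unique t_neq0 (series u)).
  exact: (xgetI 0 ux).
exact: ux.
Qed.

(** Comparison test: blocks of the series of [u] are dominated by blocks of the series of [w], so
    the partial sums are Cauchy. *)
Lemma ht_sum_to_dominated u (w : nat -> R) :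
  (forall n, ht_normE (u n) <= w n) -> cvgn (series w) ->
  ht_sum_to u (ht_sum u).
Proof.
move=> uw wc; suff [x ux] : exists x, ht_cvg (series u) x.
  by rewrite (ht_sumE _ _ ux).
apply: (ht_complete t_neq0) => e e0.
(* Both partial sums of [w] lie within e / 2 of their limit, so the block between them is below
   e. *)
have e20 : 0 < e / 2 by rewrite divr_gt0.
have [N _ wN] := cvgr_dist_lt _ _ wc _ e20.
exists N => m n; wlog mn : m n / (n <= m)%N.
  move=> H; have [/H//|/ltnW/H{}H Nm Nn] := leqP n m.
  by rewrite ht_normE_subC; apply: H.
move=> Nm Nn; rewrite sub_series_geq//.
rewrite (le_lt_trans (ht_normE_sum _ _ _ _))//.
apply: (@le_lt_trans _ _ (\sum_(n <= k < m) w k)); first exact: ler_sum.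
rewrite -sub_series_geq//; have := wN _ Nm; have := wN _ Nn => /=.
by rewrite !ltr_norml; lra.
Qed.

(** From 4 x y <= 2 (x^2 + y^2). This criterion gives the convergence of the power series, of the
    form and of the kernel. *)
Lemma ht_sum_toM alpha beta : square_summable alpha -> square_summable beta ->
  ht_sum_to (fun n => alpha n * beta n) (ht_sum (fun n => alpha n * beta n)).
Proof.
move=> sa sb; apply: (ht_sum_to_dominated _ (fun n => 2 *
   (ht_normE (alpha n) ^+ 2 + ht_normE (beta n) ^+ 2))) => [n|].
  rewrite (le_trans (ht_normEM _ _))//.
  by have := sqr_ge0 (ht_normE (alpha n) - ht_normE (beta n)); lra.
apply: is_cvg_series_scale.
exact: (is_cvg_seriesD sa sb).
Qed.

End HtSums.

(** * Powers in the unit ball and uniqueness of coefficients *)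

Section OpNorm.
Context {R : realType}.
Implicit Types (v : 'cV[R[i]]_2) (M : 'M[R[i]]_2).

Lemma cvec_norm_ge0 v : 0 <= cvec_norm v.
Proof. exact: sqrtr_ge0. Qed.

Lemma cvec_norm_sqr v :
  cvec_norm v ^+ 2 = \sum_i Normc.normc (v i 0) ^+ 2.
Proof. by rewrite sqr_sqrtr// sumr_ge0// => i _; apply: sqr_ge0. Qed.

Lemma cvec_normZ (c : R[i]) v :
  cvec_norm (c *: v) = Normc.normc c * cvec_norm v.
Proof.
rewrite /cvec_norm -[Normc.normc c in RHS]ger0_norm ?normc_ge0// -sqrtr_sqr.
rewrite -sqrtrM ?sqr_ge0// mulr_sumr; congr Num.sqrt; apply: eq_bigr => i _.
by rewrite mxE Normc.normcM exprMn.
Qed.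

Lemma cvec_norm0 : cvec_norm (0 : 'cV[R[i]]_2) = 0.
Proof. by rewrite -(scale0r 0) cvec_normZ Normc.normc0 mul0r. Qed.

Lemma normc_cvec_le v i : Normc.normc (v i 0) <= cvec_norm v.
Proof.
rewrite -(@ler_pXn2r _ 2) ?nnegrE ?normc_ge0 ?cvec_norm_ge0// cvec_norm_sqr.
by rewrite (bigD1 i)//= lerDl sumr_ge0// => j _; apply: sqr_ge0.
Qed.

Lemma normc_sum_le (I : Type) (s : seq I) (F : I -> R[i]) :
  Normc.normc (\sum_(i <- s) F i) <= \sum_(i <- s) Normc.normc (F i).
Proof.
elim/big_ind2: _ => [|x r y r' xr yr'|//]; first by rewrite Normc.normc0.
by rewrite (le_trans (le_normcD _ _))// lerD.
Qed.

(** [op_norm] is a [sup], which bounds its set only when the set is bounded. Coordinates of a vector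
    in the unit ball have modulus at most 1, so the row sums of the moduli give a bound. *)
Lemma op_norm_has_ubound M :
  has_ubound [set cvec_norm (M *m v) | v in [set v | cvec_norm v <= 1]].
Proof.
exists (Num.sqrt (\sum_i (\sum_j Normc.normc (M i j)) ^+ 2)) => _ [v /= v1 <-].
apply: ler_wsqrtr; apply: ler_sum => i _; rewrite ler_pXn2r ?nnegrE ?normc_ge0//.
  rewrite mxE (le_trans (normc_sum_le _ _ _))//; apply: ler_sum => j _.
  rewrite Normc.normcM ler_piMr ?normc_ge0//.
  exact: le_trans (normc_cvec_le _ _) v1.
by apply: sumr_ge0 => j _; apply: normc_ge0.
Qed.

(** Scaling by a positive bound [r], rather than by the norm of [v], treats the zero vector along
    with the others. *)
Lemma cvec_norm_mul_le M v (c r : R) : op_norm M <= c -> 0 < r ->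
  cvec_norm v <= r -> cvec_norm (M *m v) <= c * r.
Proof.
move=> Mc r0 vr.
have w1 : cvec_norm (r^-1%:C%C *: v) <= 1.
  by rewrite cvec_normZ normc_real gtr0_norm ?invr_gt0// ler_pdivrMl// mulr1.
have : cvec_norm (M *m (r^-1%:C%C *: v)) <= c.
  apply: le_trans Mc; apply: ub_le_sup (op_norm_has_ubound M) _ _.
  by exists (r^-1%:C%C *: v).
rewrite -scalemxAr cvec_normZ normc_real gtr0_norm ?invr_gt0//.
by rewrite ler_pdivrMl// mulrC.
Qed.

Lemma cvec_norm_expr_le M v (c : R) n : 0 < c -> op_norm M <= c ->
  cvec_norm v <= 1 -> cvec_norm (M ^+ n *m v) <= c ^+ n.
Proof.
move=> c0 Mc v1; elim: n => [|n IH]; first by rewrite !expr0 mul1mx.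
by rewrite !exprS -mulmxA; apply: cvec_norm_mul_le => //; rewrite exprn_gt0.
Qed.

End OpNorm.

Section Powers.
Context {R : realType} {t : R}.

Lemma ht_valXn (q : Ht t) n : ht_val (q ^+ n) = ht_val q ^+ n.
Proof. by elim: n => [//|n IH]; rewrite !exprS -IH. Qed.

(** The first column of q^n holds a and the conjugate of b, hence determines the Euclidean norm. It
    is the image of the first basis vector, so each entry has modulus at most c^n; the weights 1 and
    |t| give the factor. *)
Lemma ht_normE_expr_le (q : Ht t) (c : R) n : 0 < c -> op_norm q <= c ->
  ht_normE (q ^+ n) ^+ 2 <= (1 + `|t|) * (c ^+ 2) ^+ n.
Proof.
move=> c0 qc.
have e1 : cvec_norm (delta_mx 0 0 : 'cV[R[i]]_2) <= 1.
  rewrite /cvec_norm big_ord_recl big_ord1 !mxE /=.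
  by rewrite !(expr1n, expr0n, addr0, sqrtr0, sqrtr1).
have qn := cvec_norm_expr_le q _ c n c0 qc e1.
rewrite -colE in qn.
have entry i : Normc.normc (ht_val (q ^+ n) i 0) ^+ 2 <= (c ^+ 2) ^+ n.
  rewrite exprAC ler_pXn2r ?nnegrE ?normc_ge0 ?exprn_ge0 ?(ltW c0)//.
  by have := le_trans (normc_cvec_le _ i) qn; rewrite mxE ht_valXn.
rewrite ht_normE_sqr mulrDl mul1r lerD ?entry// ler_wpM2l//.
by rewrite normc_conj entry.
Qed.

Lemma Omega_square_summable (q : Ht t) : op_norm q < 1 ->
  square_summable (fun n => q ^+ n).
Proof.
(* The maximum with 1/2 keeps the ratio positive, as the power bound requires, and still below 1. *)
move=> q1; pose c := Num.max (op_norm q) 2^-1.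
have c0 : 0 < c by rewrite lt_max invr_gt0 ltr0n orbT.
have c1 : c < 1 by rewrite gt_max q1 invf_lt1// ltr1n.
apply: (square_summable_le (geometric (1 + `|t|) (c ^+ 2))) => [n|].
  by apply: ht_normE_expr_le => //; rewrite le_max lexx.
apply: is_cvg_geometric_series; rewrite ger0_norm ?sqr_ge0//.
by rewrite exprn_ilt1// ltW.
Qed.

(** Places the real scalars of absolute value below 1 in [Omega]; they are the points at which
    coefficients are identified. *)
Lemma op_norm_of_real (r : R) : op_norm (ht_of_real r : Ht t) <= `|r|.
Proof.
apply: ge_sup; first by exists (cvec_norm (ht_val (ht_of_real r : Ht t) *m 0)), 0;
  rewrite //= cvec_norm0.
move=> _ [v v1 <-].
have -> : ht_val (ht_of_real r : Ht t) = r%:C%C%:M.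
  apply/matrixP => i j; rewrite !mxE mulr0 conjc0 conjc_real.
  by case: i j => [[|[|//]] ?] [[|[|//]] ?].
by rewrite mul_scalar_mx cvec_normZ normc_real ler_piMr.
Qed.

End Powers.

(** * Uniqueness of power series coefficients *)

Section Uniqueness.
Context {R : realType} {t : R}.
Hypothesis t_neq0 : t != 0.
Implicit Types gamma alpha beta : nat -> Ht t.

Lemma series_recl {V : zmodType} (u : nat -> V) n :
  series u n.+1 = u 0%N + series (fun k => u k.+1) n.
Proof. by rewrite /series /= big_nat_recl. Qed.

Lemma ht_normE_realXM (r : R) n (x : Ht t) : 0 <= r ->
  ht_normE (ht_of_real r ^+ n * x) = r ^+ n * ht_normE x.
Proof.
move=> r0; rewrite ht_of_realXn ht_of_real_comm ht_normE_real ger0_norm//.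
exact: exprn_ge0.
Qed.

(** If the series sums to 0 at r, its head is minus its tail, and the tail has norm at most r M / (1
    - r). For small r this is less than any positive norm of the head. *)
Lemma power_series_head0 gamma (M : R) :
  (forall n, ht_normE (gamma n) <= M) ->
  (forall r : R, 0 < r -> r < 1 ->
     ht_sum_to (fun n => ht_of_real r ^+ n * gamma n) 0) ->
  gamma 0%N = 0.
Proof.
move=> gM g0; apply: (ht_normE_eq0 t_neq0); apply/eqP.
have M0 : 0 <= M := le_trans (ht_normE_ge0 _) (gM 0%N).
set x := ht_normE _; have x0 : 0 <= x := ht_normE_ge0 _.
rewrite eq_le x0 andbT leNgt; apply/negP => x_gt0.
(* Then r <= 1/2, and 4 r M = x - 2 r x < x, so r M / (1 - r) <= 2 r M < x. *)
pose r := x / (4 * M + 2 * x).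
have d0 : 0 < 4 * M + 2 * x by lra.
have r0 : 0 < r by rewrite divr_gt0.
have rE : r * (4 * M + 2 * x) = x by rewrite divfK// gt_eqF.
have r2 : r <= 2^-1 by rewrite ler_pdivrMr//; lra.
have r1 : r < 1 by lra.
suff : x <= r * M / (1 - r).
  rewrite leNgt => /negP; apply; rewrite ltr_pdivrMr; last lra.
  have : 0 <= (2^-1 - r) * x by rewrite mulr_ge0// subr_ge0.
  by move: rE; nra.
rewrite /x -[gamma 0%N]subr0.
(* The norms of [gamma 0] minus the partial sums tend to the norm of [gamma 0]. From index 1 on the
   head cancels, and a geometric sum bounds what remains. *)
have := ht_cvg_normE_subl _ _ (gamma 0%N) (g0 r r0 r1).
move=> /cvgr_to_le; apply; exists 1%N => // -[//|n] _.
rewrite series_recl expr0 mul1r opprD addNKr ht_normEN.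
rewrite (le_trans (ht_normE_sum _ _ _ _))//.
apply: le_trans (geometric_le_lim n (mulr_ge0 (ltW r0) M0) r0 _); last first.
  by rewrite gtr0_norm.
apply: ler_sum => k _; rewrite ht_normE_realXM ?(ltW r0)// /geometric /=.
have -> : r * M * r ^+ k = r ^+ k.+1 * M by rewrite exprS; ring.
by rewrite ler_wpM2l ?exprn_ge0 ?(ltW r0).
Qed.

(** Once the head vanishes, dividing the series by r > 0 gives the same hypotheses for the shifted
    coefficients; the induction therefore lets [gamma] vary. *)
Lemma power_series_eq0 gamma (M : R) :
  (forall n, ht_normE (gamma n) <= M) ->
  (forall r : R, 0 < r -> r < 1 ->
     ht_sum_to (fun n => ht_of_real r ^+ n * gamma n) 0) ->
  forall n, gamma n = 0.
Proof.
move=> gM g0 n; elim: n gamma gM g0 => [|n IH] gamma gM g0.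
  exact: power_series_head0 gM g0.
have gamma0 : gamma 0%N = 0 by apply: power_series_head0 gM g0.
apply: (IH (fun k => gamma k.+1)) => [k|r r0 r1]; first exact: gM.
pose S k := series (fun j => ht_of_real r ^+ j * gamma j) k.
have g0r : ht_normE (S k.+1 - 0) @[k --> \oo] --> (0 : R).
  by rewrite (cvg_shiftS (fun k => ht_normE (S k - 0))); apply: g0.
apply: (cvg0_squeeze _ _ r^-1 _ g0r) => k /=.
rewrite !subr0 ger0_norm ?ht_normE_ge0// /S series_recl gamma0 mulr0 add0r.
have -> : series (fun j => ht_of_real r ^+ j.+1 * gamma j.+1) k =
    ht_of_real r ^+ 1 * series (fun j => ht_of_real r ^+ j * gamma j.+1) k.
  by rewrite /series /= mulr_sumr; apply: eq_bigr => j _; rewrite exprS expr1 mulrA.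
by rewrite ht_normE_realXM ?(ltW r0)// expr1 mulKf// gt_eqF.
Qed.

Lemma power_series_sum alpha (q : Omega t) : square_summable alpha ->
  ht_sum_to (fun n => val q ^+ n * alpha n) (power_series alpha q).
Proof.
by move=> sa; apply: ht_sum_toM => //; apply: Omega_square_summable (valP q).
Qed.

Lemma power_series_inj alpha beta : square_summable alpha ->
  square_summable beta -> power_series alpha = power_series beta ->
  alpha = beta.
Proof.
move=> sa sb ab; have sab := square_summableB _ _ sa sb.
have [M abM] := square_summable_bounded _ sab.
apply/funext => n; apply/eqP; rewrite -subr_eq0; apply/eqP.
apply: (power_series_eq0 (fun k => alpha k - beta k) M abM) => r r0 r1.
have rO : op_norm (ht_of_real r : Ht t) < 1.
  by apply: le_lt_trans (op_norm_of_real r) _; rewrite gtr0_norm.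
pose q : Omega t := exist (fun q : Ht t => op_norm q < 1) _ rO.
(* The difference of the two series is formed as a sum with a right multiple by -1. *)
have := ht_sum_toD _ _ _ _ (power_series_sum _ q sa)
 (ht_sum_toMr _ _ (-1) (power_series_sum _ q sb)).
rewrite ab mulrN1 subrr.
under [X in ht_sum_to X]eq_fun do rewrite /= mulrN1 -mulrBr.
by [].
Qed.

End Uniqueness.

(** * The Hardy module and its form *)

Section HardyForm.
Context {R : realType} {t : R}.
Hypothesis t_neq0 : t != 0.
Implicit Types (alpha beta gamma delta : nat -> Ht t) (x y p q : Ht t).
Implicit Types f g h : Omega t -> Ht t.

Lemma power_series0 : power_series (fun=> 0) = 0 :> (Omega t -> Ht t).
Proof.
apply/funext => z; apply: (ht_sumE t_neq0).
have z0 n : ht_normE (series (fun n => val z ^+ n * 0) n - 0) = 0 :> R.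
  by rewrite subr0 /series /= big1 ?ht_normE0// => i _; rewrite mulr0.
by rewrite /ht_sum_to; under eq_fun do rewrite z0; apply: cvg_cst.
Qed.

Lemma power_seriesD alpha beta : square_summable alpha ->
  square_summable beta ->
  power_series (fun n => alpha n + beta n) =
  power_series alpha + power_series beta.
Proof.
move=> sa sb; apply/funext => z; apply: (ht_sumE t_neq0).
have := ht_sum_toD _ _ _ _ (power_series_sum t_neq0 _ z sa)
  (power_series_sum t_neq0 _ z sb).
by under [X in ht_sum_to X]eq_fun do rewrite -mulrDr.
Qed.

Lemma power_series_ract alpha x : square_summable alpha ->
  power_series (fun n => alpha n * x) = ract (power_series alpha) x.
Proof.
move=> sa; apply/funext => z; apply: (ht_sumE t_neq0).
have := ht_sum_toMr _ _ x (power_series_sum t_neq0 _ z sa).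
by under [X in ht_sum_to X]eq_fun do rewrite -mulrA.
Qed.

Lemma power_seriesB alpha beta : square_summable alpha ->
  square_summable beta ->
  power_series (fun n => alpha n - beta n) =
  power_series alpha - power_series beta.
Proof.
move=> sa sb; have sab := square_summableB _ _ sa sb.
have D := power_seriesD _ _ sab sb.
have ab : (fun n => alpha n - beta n + beta n) = alpha.
  by apply/funext => n; rewrite subrK.
by move: D; rewrite ab => ->; rewrite addrK.
Qed.

Lemma hardy_coef_spec f : hardy t f ->
  square_summable (hardy_coef f) /\ power_series (hardy_coef f) = f.
Proof.
move=> [alpha sa af].
exact: (@xgetI _ (fun=> 0)
  [set alpha | square_summable alpha /\ power_series alpha = f] alpha).
Qed.

(** The sequence chosen by [xget] has the same power series as [alpha], so injectivity forces it to
    be [alpha]. The form can then be computed from any given coefficients. *)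
Lemma hardy_coefE alpha : square_summable alpha ->
  hardy_coef (power_series alpha) = alpha.
Proof.
move=> sa; have [|sc] := @hardy_coef_spec (power_series alpha).
  by exists alpha.
exact: power_series_inj.
Qed.

Lemma hardy_kernel_power_series (w : Omega t) :
  hardy_kernel t ^~ w = power_series (fun n => ht_star (val w) ^+ n).
Proof. by []. Qed.

Lemma hardy_form_coef gamma delta : square_summable gamma ->
  square_summable delta ->
  hardy_form t (power_series gamma) (power_series delta) =
  ht_sum (fun n => ht_star (delta n) * gamma n).
Proof.
move=> sg sd; rewrite /hardy_form; move: (hardy_coefE _ sg) (hardy_coefE _ sd).
by move: (power_series gamma) (power_series delta) => f g -> ->.
Qed.

(* Otherwise a failed match of [power_series alpha] against [power_series beta]
   unfolds both series down to the convergence filters. *)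
#[local] Opaque power_series hardy_coef hardy_form ract.

Lemma hardy_form_sum gamma delta : square_summable gamma ->
  square_summable delta ->
  ht_sum_to (fun n => ht_star (delta n) * gamma n)
    (hardy_form t (power_series gamma) (power_series delta)).
Proof.
move=> sg sd; rewrite hardy_form_coef//.
by apply: ht_sum_toM => //; apply: square_summable_star.
Qed.

Lemma hardy_formE gamma delta x : square_summable gamma ->
  square_summable delta -> ht_sum_to (fun n => ht_star (delta n) * gamma n) x ->
  hardy_form t (power_series gamma) (power_series delta) = x.
Proof.
move=> sg sd sx; rewrite hardy_form_coef//; exact: (ht_sumE t_neq0 _ _ sx).
Qed.

Lemma hardy_form_tr_sum gamma delta : square_summable gamma ->
  square_summable delta ->
  series (fun n => ht_tr (ht_star (delta n) * gamma n)) @ \oo -->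
    ht_tr (hardy_form t (power_series gamma) (power_series delta)).
Proof. by move=> sg sd; apply/ht_sum_to_tr/hardy_form_sum. Qed.

Lemma hardy0 : hardy t 0.
Proof. by exists (fun=> 0); [apply: square_summable0|apply: power_series0]. Qed.

Lemma hardyD f g : hardy t f -> hardy t g -> hardy t (f + g).
Proof.
move=> [a sa <-] [b sb <-]; exists (fun n => a n + b n).
  exact: square_summableD.
exact: power_seriesD.
Qed.

Lemma hardy_ract f q : hardy t f -> hardy t (ract f q).
Proof.
move=> [a sa <-]; exists (fun n => a n * q); first exact: square_summableMr.
exact: power_series_ract.
Qed.

Lemma hardy_formDl f g h : hardy t f -> hardy t g -> hardy t h ->
  hardy_form t (f + g) h = hardy_form t f h + hardy_form t g h.
Proof.
move=> [a sa <-] [b sb <-] [c sc <-]; rewrite -power_seriesD//.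
apply: hardy_formE => //; first exact: square_summableD.
have := ht_sum_toD _ _ _ _ (hardy_form_sum _ _ sa sc) (hardy_form_sum _ _ sb sc).
by under [X in ht_sum_to X]eq_fun do rewrite -mulrDr.
Qed.

Lemma hardy_formDr f g h : hardy t f -> hardy t g -> hardy t h ->
  hardy_form t h (f + g) = hardy_form t h f + hardy_form t h g.
Proof.
move=> [a sa <-] [b sb <-] [c sc <-]; rewrite -power_seriesD//.
apply: hardy_formE => //; first exact: square_summableD.
have := ht_sum_toD _ _ _ _ (hardy_form_sum _ _ sc sa) (hardy_form_sum _ _ sc sb).
by under [X in ht_sum_to X]eq_fun do rewrite -mulrDl -ht_starD.
Qed.

Lemma hardy_form_ract f g p q : hardy t f -> hardy t g ->
  hardy_form t (ract f q) (ract g p) = ht_star p * hardy_form t f g * q.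
Proof.
move=> [a sa <-] [b sb <-]; have fq := power_series_ract _ q sa.
have gp := power_series_ract _ p sb.
apply: (eq_trans (congr2 (hardy_form t) (esym fq) (esym gp))).
apply: hardy_formE; [exact: square_summableMr|exact: square_summableMr|].
have := ht_sum_toMr _ _ q (ht_sum_toMl _ _ (ht_star p) (hardy_form_sum _ _ sa sb)).
by under [X in ht_sum_to X]eq_fun do rewrite mulrA -ht_starM -mulrA.
Qed.

(** Both sides are limits of the same real series, since the trace of each term is unchanged by
    exchanging the factors under star. *)
Lemma hardy_form_tr_sym f g : hardy t f -> hardy t g ->
  ht_tr (hardy_form t f g) = ht_tr (hardy_form t g f).
Proof.
move=> [a sa <-] [b sb <-].
have := hardy_form_tr_sum _ _ sb sa.
under [X in series X]eq_fun do rewrite ht_tr_starM_sym.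
exact: cvg_unique (hardy_form_tr_sum _ _ sa sb).
Qed.

(** The decay is that of the powers of [w]: star commutes with powers and preserves the Euclidean
    norm. *)
Lemma star_expr_square_summable (w : Omega t) :
  square_summable (fun n => ht_star (val w) ^+ n).
Proof.
have := square_summable_star _ (Omega_square_summable (val w) (valP w)).
by rewrite /square_summable; under eq_fun do rewrite ht_starXn.
Qed.

(** The reproducing identity holds already for the form with values in [Ht t]; taking traces gives
    the required one. *)
Lemma hardy_form_kernel f (w : Omega t) x : hardy t f ->
  hardy_form t f (ract (hardy_kernel t ^~ w) x) = ht_star x * f w.
Proof.
move=> [a sa <-]; have sw := star_expr_square_summable w.
rewrite hardy_kernel_power_series -power_series_ract//.
apply: hardy_formE => //; first exact: square_summableMr.
have := ht_sum_toMl _ _ (ht_star x) (power_series_sum t_neq0 _ w sa).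
have E n : ht_star x * (val w ^+ n * a n) =
    ht_star (ht_star (val w) ^+ n * x) * a n.
  by rewrite ht_starM -ht_starXn ht_starK mulrA.
by under [X in ht_sum_to X]eq_fun do rewrite E.
Qed.

End HardyForm.

(** * Hilbert subspaces cut out by a coefficient condition *)

Section HardyPart.
Context {R : realType} {t : R}.
Hypothesis t_neq0 : t != 0.
Implicit Types (alpha beta gamma delta : nat -> Ht t) (x y : Ht t).

Local Notation V := (realified (Omega t -> Ht t)).
Implicit Types f g h : V.

Definition hardy_tr_form f g : R := ht_tr (hardy_form t f g).
Local Notation B := hardy_tr_form.

Lemma realified_scaleE (r : R) f :
  r *: f = ract (f : Omega t -> Ht t) (ht_of_real r).
Proof. by []. Qed.

Lemma hardy_subspace : real_subspace (V := V) (hardy t).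
Proof.
split=> [|r f g Hf Hg]; first exact: hardy0.
rewrite realified_scaleE; apply: (hardyD t_neq0); last exact: Hg.
exact: (hardy_ract t_neq0).
Qed.

Lemma hardy_sym_bilinear : sym_bilinear_on (V := V) (hardy t) B.
Proof.
split=> [r f g h Hf Hg Hh|f g Hf Hg]; last exact: (hardy_form_tr_sym t_neq0).
(* The module law of the form acts on both arguments, so h is written as h times 1; star 1 = 1 is
   then read off the zeroth power. *)
have ract1 : h = ract (h : Omega t -> Ht t) 1 by rewrite /ract scale1r.
rewrite realified_scaleE /B (hardy_formDl t_neq0) ?ht_trD//; last first.
  exact: (hardy_ract t_neq0).
congr (_ + _); rewrite {1}ract1 (hardy_form_ract t_neq0)//.
by rewrite (ht_starXn 1 0) expr0 mul1r ht_tr_of_realM.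
Qed.

(** Both summands of the Krein decomposition are treated at once: [P] is the closed real subspace
    allowed for coefficients, and [s] is the sign that makes the trace form on it twice the squared
    Euclidean norm. *)
Variables (P : set (Ht t)) (s : R).
Hypotheses (P0 : P 0)
  (P_comb : forall (r : R) x y, P x -> P y -> P (x * ht_of_real r + y))
  (P_closed : forall (u : nat -> Ht t) x, (forall n, P (u n)) -> ht_cvg u x -> P x)
  (P_norm : forall x, P x -> s * ht_tr (ht_star x * x) = 2 * ht_normE x ^+ 2).

Definition hardy_part : set V :=
  [set power_series alpha | alpha in
    [set alpha : nat -> Ht t | square_summable alpha /\ forall n, P (alpha n)]].

Let PB x y : P x -> P y -> P (x - y).
Proof.
move=> Px Py; have := P_comb (-1) y x Py Px; rewrite addrC.
suff -> : y * ht_of_real (-1) = - y by [].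
rewrite ht_of_realM; apply: ht_ext; rewrite ?ht_aE ?ht_bE ?ht_aN ?ht_bN.
  by rewrite rmorphN1 mulrN1.
by rewrite rmorphN1 mulrN1.
Qed.

Lemma hardy_part_sub : hardy_part `<=` hardy t.
Proof. by move=> _ [alpha [sa _] <-]; exists alpha. Qed.

Lemma hardy_part_norm_sum alpha : square_summable alpha ->
  (forall n, P (alpha n)) ->
  series (fun n => 2 * ht_normE (alpha n) ^+ 2) @ \oo -->
    s * B (power_series alpha) (power_series alpha).
Proof.
move=> sa Pa; set tr_sum := series (fun n => ht_tr (ht_star (alpha n) * alpha n)).
have -> : series (fun n => 2 * ht_normE (alpha n) ^+ 2) =
    (fun n => s * tr_sum n).
  apply/funext => n; rewrite /tr_sum /series /= mulr_sumr.
  by apply: eq_bigr => k _; rewrite P_norm.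
by apply: cvgMr; apply: hardy_form_tr_sum.
Qed.

(** The empty partial sum, n = 0, gives nonnegativity of s times the form, which later cancels the
    square root in [form_norm]. *)
Lemma hardy_part_partial_le alpha n : square_summable alpha ->
  (forall n, P (alpha n)) ->
  series (fun n => 2 * ht_normE (alpha n) ^+ 2) n <=
    s * B (power_series alpha) (power_series alpha).
Proof.
move=> sa Pa; have H := hardy_part_norm_sum _ sa Pa.
rewrite -(cvg_lim (@Rhausdorff R) H); apply: series_nneg_le_lim => [k|].
  by rewrite mulr_ge0 ?sqr_ge0.
exact: cvgP H.
Qed.

Lemma hardy_part_subspace : real_subspace hardy_part.
Proof.
split=> [|r f g [a [sa Pa] <-] [b [sb Pb] <-]].
  exists (fun=> 0); last exact: (power_series0 t_neq0).
  by split=> //; apply: square_summable0.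
have sar := square_summableMr _ (ht_of_real r) sa.
exists (fun n => a n * ht_of_real r + b n).
  by split=> [|n]; [apply: square_summableD|apply: P_comb].
by rewrite realified_scaleE (power_seriesD t_neq0)// (power_series_ract t_neq0).
Qed.

Lemma hardy_part_pos_definite :
  pos_definite_on hardy_part (fun f g => s * B f g).
Proof.
move=> _ [a [sa Pa] <-] a0; rewrite ltNge; apply/negP => B0; apply: a0.
suff -> : a = fun=> 0 by exact: (power_series0 t_neq0).
apply/funext => n; apply: (ht_normE_eq0 t_neq0); apply/eqP.
rewrite -(sqrf_eq0 (ht_normE _)) eq_le sqr_ge0 andbT.
(* The partial sum of length n + 1 contains the term of index n, and the remaining terms are
   nonnegative. *)
have := le_trans (hardy_part_partial_le a n.+1 sa Pa) B0.
rewrite seriesSr; have : 0 <= series (fun n => 2 * ht_normE (a n) ^+ 2) n.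
  by apply: sumr_ge0 => k _; rewrite mulr_ge0 ?sqr_ge0.
by lra.
Qed.

(** The completeness argument for l^2: each coefficient is Cauchy and has a limit [L j]. Finite
    partial sums of the squared differences pass to the limit in n at fixed length J, and the
    resulting bound is uniform in J. *)
Lemma hardy_part_complete : complete_on hardy_part (fun f g => s * B f g).
Proof.
move=> u uS uC; set D := form_norm _ in uC *.
pose a n := hardy_coef (u n).
have aP n : [/\ square_summable (a n), forall j, P (a n j)
    & power_series (a n) = u n].
  have [b [sb Pb] bu] := uS n.
  by rewrite /a -bu (hardy_coefE t_neq0).
have D_le f J b : square_summable b -> (forall j, P (b j)) ->
    power_series b = f ->
    series (fun j => 2 * ht_normE (b j) ^+ 2) J <= D f ^+ 2.
  move=> sb Pb <-; rewrite sqr_sqrtr; first exact: hardy_part_partial_le.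
  by have := hardy_part_partial_le b 0 sb Pb; rewrite {1}/series /= big_geq.
have D_ge0 f : 0 <= D f := sqrtr_ge0 _.
have duE m n : power_series (fun j => a m j - a n j) = u m - u n :> V.
  have [sm _ um] := aP m; have [sn _ un] := aP n.
  by rewrite (power_seriesB t_neq0)// um un.
have D_sub J m n :
    series (fun j => 2 * ht_normE (a m j - a n j) ^+ 2) J <= D (u m - u n) ^+ 2.
  have [sm Pm _] := aP m; have [sn Pn _] := aP n.
  apply: D_le (duE m n); first exact: square_summableB.
  by move=> j; apply: PB.
have a_cvg j : exists x, ht_cvg (fun n => a n j) x.
  apply: (ht_complete t_neq0) => e e0; have [N uN] := uC e e0.
  exists N => m n Nm Nn; apply: le_lt_trans (uN m n Nm Nn).
  rewrite -(@ler_pXn2r _ 2) ?nnegrE ?ht_normE_ge0//.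
  apply: le_trans (D_sub j.+1 m n); rewrite seriesSr.
  have : 0 <= series (fun j => 2 * ht_normE (a m j - a n j) ^+ 2) j.
    by apply: sumr_ge0 => k _; rewrite mulr_ge0 ?sqr_ge0.
  by have := sqr_ge0 (ht_normE (a m j - a n j)); lra.
have [L aL] := choice a_cvg.
(* Closedness of [P] keeps the limit in the same summand. *)
have PL j : P (L j) by apply: P_closed (aL j) => n; have [_ + _] := aP n.
have part_cvg m J : series (fun j => 2 * ht_normE (a m j - a n j) ^+ 2) J
    @[n --> \oo] --> series (fun j => 2 * ht_normE (a m j - L j) ^+ 2) J.
  elim: J => [|J IH].
    by rewrite /series /= big_geq//; under eq_fun do rewrite big_geq//;
      apply: cvg_cst.
  rewrite seriesSr; under eq_fun do rewrite seriesSr.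
  apply: cvgD => //; apply: cvgMr; apply: cvgM; exact: ht_cvg_normE_subl.
have part_le e : 0 < e -> exists N, forall m J, (N <= m)%N ->
    series (fun j => 2 * ht_normE (a m j - L j) ^+ 2) J <= e ^+ 2.
  move=> e0; have [N uN] := uC e e0; exists N => m J Nm.
  apply: cvgr_to_le (part_cvg m J) _; exists N => // n /= Nn.
  apply: le_trans (D_sub J m n) _.
  by rewrite ler_pXn2r ?nnegrE ?(ltW e0)// ltW// uN.
have sub_summable e m : (forall J,
    series (fun j => 2 * ht_normE (a m j - L j) ^+ 2) J <= e ^+ 2) ->
    square_summable (fun j => a m j - L j).
  move=> le_e; apply: (square_summable_le
    (fun j => 2 * ht_normE (a m j - L j) ^+ 2)) => [j|].
    by have := sqr_ge0 (ht_normE (a m j - L j)); lra.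
  apply: nondecreasing_is_cvgn; last by exists (e ^+ 2) => _ [J _ <-].
  by apply: nondecreasing_series => j _ _; rewrite mulr_ge0 ?sqr_ge0.
(* L is the difference of a N and a N - L, both square summable; the tolerance 1 is an arbitrary
   choice. *)
have sL : square_summable L.
  have [N part_N] := part_le 1 ltr01.
  have sN := sub_summable 1 N (fun J => part_N N J (leqnn N)).
  have [sa _ _] := aP N.
  have := square_summableB _ _ sa sN.
  by rewrite /square_summable; under eq_fun do rewrite opprB addrC subrK.
exists (power_series L); first by exists L.
apply/cvgr0Pnorm_le => e e0; have [N part_N] := part_le e e0.
exists N => // m /= Nm; rewrite ger0_norm; last exact: D_ge0.
have [sm Pm um] := aP m.
have sd := square_summableB _ _ sm sL.
rewrite -(@ler_pXn2r _ 2) ?nnegrE ?(ltW e0) ?D_ge0//.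
have -> : u m - power_series L = power_series (fun j => a m j - L j) :> V.
  by rewrite (power_seriesB t_neq0)// um.
have Pd j : P (a m j - L j) by apply: PB.
have nd := hardy_part_norm_sum _ sd Pd.
rewrite sqr_sqrtr; last first.
  by have := hardy_part_partial_le _ 0 sd Pd; rewrite {1}/series /= big_geq.
(* The squared form norm is the limit over J of partial sums that are all at most e^2. *)
by apply: cvgr_to_le nd _; apply: nearW => J; apply: part_N.
Qed.

Lemma hardy_part_hilbert : hilbert_space hardy_part (fun f g => s * B f g).
Proof.
split; [exact: hardy_part_subspace| |exact: hardy_part_pos_definite
  |exact: hardy_part_complete].
have [Bl Bs] := hardy_sym_bilinear; split=> [r f g h|f g].
  move=> /hardy_part_sub Hf /hardy_part_sub Hg /hardy_part_sub Hh.
  by rewrite Bl// mulrDr mulrCA.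
by move=> /hardy_part_sub Hf /hardy_part_sub Hg; rewrite Bs.
Qed.

End HardyPart.

(** * The Krein decomposition *)

Section HardyKrein.
Context {R : realType} {t : R}.
Hypothesis t_neq0 : t != 0.
Implicit Types (x y : Ht t) (u : nat -> Ht t).
Local Notation V := (realified (Omega t -> Ht t)).

Lemma ht_a_closed u x : (forall n, ht_a (u n) = 0) -> ht_cvg u x -> ht_a x = 0.
Proof.
move=> u0 ux; apply: Normc.eq0_normc; apply/eqP.
rewrite eq_le normc_ge0 andbT; apply: cvgr_to_ge ux _; apply: nearW => n.
by apply: le_trans (normc_a_le _); rewrite ht_aB u0 sub0r normcN.
Qed.

Lemma ht_b_closed u x : (forall n, ht_b (u n) = 0) -> ht_cvg u x -> ht_b x = 0.
Proof.
move=> u0 ux; apply: Normc.eq0_normc; apply/eqP.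
have s0 : 0 < Num.sqrt `|t| by rewrite sqrtr_gt0 normr_gt0.
rewrite eq_le normc_ge0 andbT -(pmulr_rle0 _ s0).
apply: cvgr_to_ge ux _; apply: nearW => n.
by apply: le_trans (normc_b_le _); rewrite ht_bB u0 sub0r normcN.
Qed.

(* For [t < 0], [ht_pos] is the whole algebra and [ht_neg] is [0]. *)
Definition ht_pos : set (Ht t) := [set x | 0 < t -> ht_b x = 0].
Definition ht_neg : set (Ht t) := [set x | ht_a x = 0 /\ (t < 0 -> ht_b x = 0)].

Lemma ht_pos_comb (r : R) x y :
  ht_pos x -> ht_pos y -> ht_pos (x * ht_of_real r + y).
Proof.
move=> px py t0; rewrite ht_bD ht_of_realM ht_bE.
by rewrite (px t0) (py t0) mul0r addr0.
Qed.

Lemma ht_neg_comb (r : R) x y :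
  ht_neg x -> ht_neg y -> ht_neg (x * ht_of_real r + y).
Proof.
move=> [xa xb] [ya yb]; split=> [|t0].
  by rewrite ht_aD ht_of_realM ht_aE xa ya mul0r addr0.
by rewrite ht_bD ht_of_realM ht_bE (xb t0) (yb t0) mul0r addr0.
Qed.

Lemma ht_pos_norm x :
  ht_pos x -> 1 * ht_tr (ht_star x * x) = 2 * ht_normE x ^+ 2.
Proof.
move=> px; rewrite mul1r ht_tr_starMM ht_normE_sqr.
have [t0|t0|/eqP] := ltgtP t 0; last by rewrite (negPf t_neq0).
- by rewrite ltr0_norm// mulNr.
- by rewrite (px t0) Normc.normc0 expr0n !mulr0 subr0 addr0.
Qed.

Lemma ht_neg_norm x :
  ht_neg x -> -1 * ht_tr (ht_star x * x) = 2 * ht_normE x ^+ 2.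
Proof.
move=> [xa xb]; rewrite mulN1r ht_tr_starMM ht_normE_sqr xa Normc.normc0.
rewrite expr0n /= !add0r mulrN opprK.
have [t0|t0|/eqP] := ltgtP t 0; last by rewrite (negPf t_neq0).
- by rewrite (xb t0) Normc.normc0 expr0n !mulr0.
- by rewrite gtr0_norm.
Qed.

Lemma hardy_pos_hilbert :
  hilbert_space (V := V) (hardy_part ht_pos) hardy_tr_form.
Proof.
have -> : hardy_tr_form = (fun f g : V => 1 * hardy_tr_form f g).
  by apply/funext => f; apply/funext => g; rewrite mul1r.
apply: (hardy_part_hilbert t_neq0 ht_pos 1) => [t0|||].
- exact: ht_b0.
- exact: ht_pos_comb.
- by move=> u x pu ux t0; apply: ht_b_closed ux => n; apply: pu.
- exact: ht_pos_norm.
Qed.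

Lemma hardy_neg_hilbert :
  hilbert_space (V := V) (hardy_part ht_neg) (fun f g => - hardy_tr_form f g).
Proof.
have -> : (fun f g : V => - hardy_tr_form f g) =
    (fun f g : V => -1 * hardy_tr_form f g).
  by apply/funext => f; apply/funext => g; rewrite mulN1r.
apply: (hardy_part_hilbert t_neq0 ht_neg (-1)).
- by split=> [|_]; [exact: ht_a0|exact: ht_b0].
- exact: ht_neg_comb.
- move=> u x nu ux; split=> [|t0].
    by apply: ht_a_closed ux => n; have [] := nu n.
  by apply: ht_b_closed ux => n; have [_] := nu n; apply.
- exact: ht_neg_norm.
Qed.

Lemma hardy_pos_neg_orthogonal (f g : V) :
  hardy_part ht_pos f -> hardy_part ht_neg g -> hardy_tr_form f g = 0.
Proof.
move=> [a [sa pa] <-] [b [sb nb] <-]; rewrite /hardy_tr_form.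
have E n : ht_tr (ht_star (b n) * a n) = 0.
  (* The [ht_a] term vanishes through b n; in the [ht_b] term the factor from b n vanishes if t < 0
     and the one from a n if t > 0. *)
  rewrite ht_tr_starM; have [-> bb] := nb n; rewrite conjc0 mul0r.
  have [t0|t0|/eqP] := ltgtP t 0; last by rewrite (negPf t_neq0).
    by rewrite (bb t0) mulr0 /= !mulr0 subrr mulr0.
  by rewrite (pa n t0) conjc0 mul0r /= !mulr0 subrr mulr0.
have := hardy_form_tr_sum t_neq0 _ _ sa sb.
have -> : series (fun n => ht_tr (ht_star (b n) * a n)) = cst 0.
  by apply/funext => n; rewrite /series /= big1.
by move=> /(cvg_unique (@Rhausdorff R) (cvg_cst 0)).
Qed.

Definition ht_pos_proj x : Ht t := if 0 < t then ht t (ht_a x) 0 else x.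

Lemma ht_pos_proj_pos x : ht_pos (ht_pos_proj x).
Proof. by move=> t0; rewrite /ht_pos_proj t0 ht_bE. Qed.

Lemma ht_pos_proj_neg x : ht_neg (x - ht_pos_proj x).
Proof.
rewrite /ht_pos_proj; case: ifP => t0.
  split=> [|/(lt_trans t0)]; last by rewrite ltxx.
  by rewrite ht_aB ht_aE subrr.
by rewrite subrr; split=> [|_]; [exact: ht_a0|exact: ht_b0].
Qed.

(** Contractivity keeps the projected coefficients square summable, so the coefficientwise splitting
    stays in the module. *)
Lemma ht_pos_proj_le x : ht_normE (ht_pos_proj x) <= 1 * ht_normE x.
Proof.
rewrite mul1r /ht_pos_proj; case: ifP => // _.
rewrite -(@ler_pXn2r _ 2) ?nnegrE ?ht_normE_ge0// !ht_normE_sqr ht_aE ht_bE.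
by rewrite Normc.normc0 expr0n mulr0 addr0 lerDl normr_sqr_ge0.
Qed.

Lemma hardy_pos_neg_decomp :
  hardy t = [set u + v | u in hardy_part ht_pos & v in hardy_part ht_neg].
Proof.
apply/seteqP; split=> [_ [a sa <-]|_ [f [c [sc _] <-] [g [d [sd _] <-] <-]]];
  last by apply: (hardyD t_neq0); [exists c|exists d].
have sp : square_summable (fun n => ht_pos_proj (a n)).
  by apply: (square_summable_bounded_by 1 _ _ _ sa) => n; apply: ht_pos_proj_le.
have sn := square_summableB _ _ sa sp.
exists (power_series (fun n => ht_pos_proj (a n))).
  by exists (fun n => ht_pos_proj (a n)); split=> // n; apply: ht_pos_proj_pos.
exists (power_series (fun n => a n - ht_pos_proj (a n))).
  exists (fun n => a n - ht_pos_proj (a n)) => //; split=> // n.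
  exact: ht_pos_proj_neg.
by rewrite (power_seriesB t_neq0)// addrC subrK.
Qed.

(** A common element is orthogonal to itself, which positive definiteness on the first summand
    allows only for 0. *)
Lemma hardy_pos_neg_disjoint :
  hardy_part ht_pos `&` hardy_part ht_neg = [set (0 : V)].
Proof.
have [p0 _] := hardy_part_subspace t_neq0 ht_pos
  (fun _ => ht_b0) ht_pos_comb.
have [n0 _] := hardy_part_subspace t_neq0 ht_neg
  (conj ht_a0 (fun _ => ht_b0)) ht_neg_comb.
apply/seteqP; split=> [f [pf nf]|_ ->]; last by split.
apply: contrapT => f0.
have [_ _ pd _] := hardy_pos_hilbert.
by have := pd f pf f0; rewrite hardy_pos_neg_orthogonal// ltxx.
Qed.

Lemma hardy_krein_space : krein_space (V := V) (hardy t) hardy_tr_form.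
Proof.
split; [exact: hardy_subspace|exact: hardy_sym_bilinear|].
exists (hardy_part ht_pos), (hardy_part ht_neg); split.
- exact: hardy_pos_hilbert.
- exact: hardy_neg_hilbert.
- exact: hardy_pos_neg_decomp.
- exact: hardy_pos_neg_disjoint.
- exact: hardy_pos_neg_orthogonal.
Qed.

(** The constant function with value x, whose only nonzero coefficient can be the one of index 0; it
    carries the signs of the trace form on [Ht t] over to the module. *)
Lemma hardy_const x : exists2 f : V, hardy t f &
  hardy_tr_form f f = ht_tr (ht_star x * x).
Proof.
pose a (n : nat) := if n == 0%N then x else 0.
have a_series (u : nat -> R) : (forall n, u n.+1 = 0) ->
    series u @ \oo --> u 0%N.
  move=> u0; rewrite -(cvg_shiftS (series u)).
  have E n : series u n.+1 = u 0%N.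
    by rewrite series_recl /series /= big1 ?addr0.
  by under eq_fun do rewrite E; apply: cvg_cst.
have sa : square_summable a.
  apply: cvgP (a_series (fun n => ht_normE (a n) ^+ 2) _) => n.
  by rewrite /a /= ht_normE0 expr0n.
exists (power_series a); first by exists a.
apply: (cvg_unique (@Rhausdorff R) (hardy_form_tr_sum t_neq0 _ _ sa sa)).
apply: (a_series (fun n => ht_tr (ht_star (a n) * a n))) => n.
by rewrite /a /= mulr0 ht_tr0.
Qed.

(** The coefficient 1 gives the value 2, and the coefficient with a = 0 and b = 1 gives -2t. *)
Lemma hardy_indefinite :
  0 < t -> indefinite_on (V := V) (hardy t) hardy_tr_form.
Proof.
move=> t0; split.
  have [f Hf Bf] := hardy_const 1; exists f => //; rewrite Bf ht_tr_starMM.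
  by rewrite ht_a1 ht_b1 Normc.normc0 Normc.normc1 expr0n expr1n mulr0 subr0.
have [f Hf Bf] := hardy_const (ht t 0 1); exists f => //; rewrite Bf.
rewrite ht_tr_starMM ht_aE ht_bE Normc.normc0 Normc.normc1 expr0n expr1n.
by rewrite mulr1 sub0r mulrN oppr_lt0 mulr_gt0.
Qed.

(** For t < 0 the condition [ht_pos] is vacuous, so the positive summand is the whole module. *)
Lemma hardy_pos_definite :
  t < 0 -> pos_definite_on (V := V) (hardy t) hardy_tr_form.
Proof.
move=> t0 f [a sa af]; have [_ _ pd _] := hardy_pos_hilbert; apply: pd.
by exists a => //; split=> // n t1; have := lt_trans t0 t1; rewrite ltxx.
Qed.

Lemma hardy_rk_krein_module :
  rk_krein_module (hardy t) (hardy_form t) (hardy_kernel t).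
Proof.
split.
- split.
  + split; [exact: hardy0|exact: hardyD|].
    by move=> f q; apply: hardy_ract.
  + move=> f g h Hf Hg Hh; split; first exact: hardy_formDl.
    exact: hardy_formDr.
  + by move=> f g p q Hf Hg; apply: hardy_form_ract.
  + exact: hardy_krein_space.
- move=> w b; apply: (hardy_ract t_neq0).
  exists (fun n => ht_star (val w) ^+ n) => //.
  exact: star_expr_square_summable.
- by move=> f w b Hf; rewrite hardy_form_kernel.
Qed.

End HardyKrein.

Theorem theorem4p4 (R : realType) (t : R) (t_neq0 : t != 0) :
  [/\ [/\ (forall (alpha : nat -> Ht t) (q : Omega t), square_summable alpha ->
              ht_sum_to (fun n => val q ^+ n * alpha n) (power_series alpha q)),
          (forall gamma delta : nat -> Ht t,
              square_summable gamma -> square_summable delta ->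
              ht_sum_to (fun n => ht_star (delta n) * gamma n)
                (hardy_form t (power_series gamma) (power_series delta)) /\
              series (fun n => ht_tr (ht_star (delta n) * gamma n)) @ \oo -->
                ht_tr (hardy_form t (power_series gamma) (power_series delta)))
        & (forall q p : Omega t,
              ht_sum_to (fun n => val q ^+ n * ht_star (val p) ^+ n)
                (hardy_kernel t q p))],
      (0 < t -> indefinite_on (V := realified (Omega t -> Ht t)) (hardy t)
                  (fun f g => ht_tr (hardy_form t f g))),
      (t < 0 -> pos_definite_on (V := realified (Omega t -> Ht t)) (hardy t)
                  (fun f g => ht_tr (hardy_form t f g)))
    & rk_krein_module (hardy t) (hardy_form t) (hardy_kernel t)].
Proof.
split; [split| | |].
- by move=> alpha q sa; apply: (power_series_sum t_neq0).
- move=> gamma delta sg sd; split; first exact: (hardy_form_sum t_neq0).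
  exact: (hardy_form_tr_sum t_neq0).
- move=> q p; apply: (power_series_sum t_neq0).
  exact: star_expr_square_summable.
- exact: (hardy_indefinite t_neq0).
- exact: (hardy_pos_definite t_neq0).
- exact: (hardy_rk_krein_module t_neq0).
Qed.
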